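(* Let $n\ge 1$ and $0\le k\le n$. The representations $\bigwedge^k\mathcal R_n$ and $\mathcal W_{n,k/0}$ of the string link monoid $\mathrm{Str}(n)$ are isomorphic to each other. That is (after extending scalars of $\bigwedge^k\mathcal R_n$ from $\mathbb Q(t)$ to $\mathbb Q(t^{1/2})$), there is a $\mathbb Q(t^{1/2})$-linear isomorphism $\Phi: W_{n,k}\otimes_{\mathbb Z[t^{1/2},t^{-1/2}]}\mathbb Q(t^{1/2})\to \bigwedge^k\mathbb Q(t^{1/2})^n$ such that $\Phi\,\mathcal W_{n,k/0}(T)=\bigl(\bigwedge^k\mathcal R_n(T)\bigr)\,\Phi$ for all $T\in\mathrm{Str}(n)$.
   Context: Tangles and string links. Tangles are oriented tangles in $\mathbb R\times[0,1]$ (presented by diagrams, up to isotopy and Reidemeister moves). A tangle $T:\iota^n\to\iota^n$ has bottom endpoints $(1,0),\dots,(n,0)$ and top endpoints $(1,1),\dots,(n,1)$, with the strands oriented upwards at all endpoints; it may have closed components. The composite $T\circ S$ is obtained by stacking $T$ on top of $S$. A string link on $n$ strands is a tangle $\iota^n\to\iota^n$ consisting of precisely $n$ interval components (and no closed components), each having one endpoint at the bottom and the other at the top (the permutation of endpoints is arbitrary). String links form a monoid $\mathrm{Str}(n)$ containing the braid group $B_n$. The generator $\sigma_i\in B_n$ is the positive crossing (both strands upwards) in which the overcrossing strand goes from bottom position $i$ to top position $i+1$ and the undercrossing strand from bottom position $i+1$ to top position $i$. The (partial) closure of a braid $b\in B_{n+m}$ is the tangle $\iota^n\to\iota^n$ obtained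 by connecting, for $j=n+1,\dots,n+m$, the top endpoint of $b$ at position $j$ to its bottom endpoint at position $j$ by disjoint arcs passing to the right of $b$. Every tangle $\iota^n\to\iota^n$ is such a closure. Random walk invariant $\mathcal R_n$ (Lin–Tian–Wang). An admissible path in a diagram of $T\in\mathrm{Str}(n)$ starts at a bottom point $(i,0)$, ends at a top point $(j,1)$, and follows the diagram along its orientation. When it reaches a crossing along the undercrossing piece, it must continue along that piece. When it reaches a crossing along the overcrossing piece, it may either continue along it or switch to the undercrossing piece and continue in the direction of the latter. Crossings may be passed repeatedly. The weight $w(P)$ of an admissible path $P$ is the product over all crossing passages (with repetition) of: $1$ if the crossing is approached along the undercrossing piece; $t$ if the crossing is positive, approached along the overcrossing piece, and $P$ continues along it; $1-t$ if the crossing is positive, approached along the overcrossing piece, and $P$ switches; $t^{-1}$, respectively $1-t^{-1}$, in the corresponding cases for a negative crossing. $\mathcal R_n(T)$ is the $n\times n$ matrix with $(j,i)$ entry $\mathcal R_n(T)_{j,i}=\sum_P w(P)$, summing over all admissible paths $P$ from $(i,0)$ to $(j,1)$ ($0$ if there are none). For $t$ sufficiently close to $1$ the sums converge to rational functions of $t$, independent of the diagram, so $\mathcal R_n(T)$ is a matrix over $\mathbb Q(t)$, and $\mathcal R_n:\mathrm{Str}(n)\to\mathrm{End}(\mathbb Q(t)^n)$ is a homomorphism of monoids. $\bigwedge^k\mathcal R_n(T)$ is the induced endomorphism of $\bigwedge^k\mathbb Q(t)^n$, $x_1\wedge\dots\wedge x_k\mapsto (\mathcal R_n(T)x_1)\wedge\dots\wedge(\mathcal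 R_n(T)x_k)$. Ohtsuki's tangle functor $\mathcal V$. Let $V$ be the free $\mathbb Z[t^{1/2},t^{-1/2}]$-module with basis $e_0,e_1$. Let $R\in\mathrm{End}(V\otimes V)$ be given by $R(e_0\otimes e_0)=t^{-1/2}e_0\otimes e_0$, $R(e_0\otimes e_1)=e_1\otimes e_0$, $R(e_1\otimes e_0)=e_0\otimes e_1+(t^{-1/2}-t^{1/2})e_1\otimes e_0$, $R(e_1\otimes e_1)=-t^{1/2}e_1\otimes e_1$. For braids, $\mathcal V:B_n\to\mathrm{End}(V^{\otimes n})$ is the homomorphism $\sigma_i\mapsto \mathrm{id}^{\otimes i-1}\otimes R\otimes\mathrm{id}^{\otimes n-i-1}$. Let $h=t^{1/2}\,\mathrm{diag}(1,-1)$ on $V$ and $\mathrm{Tr}_m(g)=\mathrm{trace}_{V^{\otimes m}}(h^{\otimes m}g)$ for $g\in\mathrm{End}(V^{\otimes m})$. If $T:\iota^n\to\iota^n$ is the closure of $b\in B_{n+m}$, then $\mathcal V(T)=(\mathrm{id}\otimes\mathrm{Tr}_m)(\mathcal V(b))\in\mathrm{End}(V^{\otimes n})$, using $\mathrm{End}(V^{\otimes(n+m)})\cong\mathrm{End}(V^{\otimes n})\otimes\mathrm{End}(V^{\otimes m})$. This is independent of the choice of $b$ (it is the value on $T$ of Ohtsuki's functor associated to the Alexander polynomial), and $\mathcal V(T\circ S)=\mathcal V(T)\mathcal V(S)$. Graded parts. $W_{n,k}\subset V^{\otimes n}$ is the span of the $e_{i_1}\otimes\dots\otimes e_{i_n}$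 with exactly $k$ of the indices $i_s$ equal to $1$ (rank $\binom nk$). $\mathcal V(T)$ preserves each $W_{n,k}$, and $\mathcal W_{n,k}(T)=\mathcal V(T)|_{W_{n,k}}$. Since $W_{n,0}$ has rank one, $\mathcal W_{n,0}(T)$ is an element of $\mathbb Z[t^{1/2},t^{-1/2}]$; it is nonzero for every string link $T$. For $T\in\mathrm{Str}(n)$ put $\mathcal W_{n,k/0}(T)=\frac{1}{\mathcal W_{n,0}(T)}\mathcal W_{n,k}(T)$, an endomorphism of $W_{n,k}\otimes\mathbb Q(t^{1/2})$; this is a representation of $\mathrm{Str}(n)$. *)

(* Defs.v *)
From HB Require Import structures.
From mathcomp Require Import all_boot all_order all_algebra perm.
From mathcomp Require Import all_classical all_reals all_analysis.

Set Implicit Arguments.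
Unset Strict Implicit.
Unset Printing Implicit Defensive.

Import Order.TTheory GRing.Theory Num.Theory.
Import numFieldNormedType.Exports.

Local Open Scope ring_scope.

(** * Braid words and their partial closures

   Positions are numbered from 0. The letter [(i, true)] is the generator
   exchanging the positions i and i + 1, and [(i, false)] is its inverse.
   A word lists its crossings from bottom to top.

   A tangle with n bottom and n top endpoints is presented by [m] and a word
   [b] in [braid_word (n + m)]: it is the closure of [b] along the positions
   n, ..., n + m - 1. *)

Definition letter (N : nat) := ('I_N.-1 * bool)%type.
Definition braid_word (N : nat) := seq (letter N).

Lemma posl_subproof (N : nat) (i : 'I_N.-1) : (i < N)%N.
Proof. exact: leq_trans (ltn_ord i) (leq_pred N). Qed.

Lemma posr_subproof (N : nat) (i : 'I_N.-1) : (i.+1 < N)%N.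
Proof. by rewrite -ltn_predRL. Qed.

Definition posl (N : nat) (i : 'I_N.-1) : 'I_N := Ordinal (posl_subproof i).
Definition posr (N : nat) (i : 'I_N.-1) : 'I_N := Ordinal (posr_subproof i).

(* In a positive letter the overcrossing strand goes from i to i + 1; its
   inverse is the mirror image in a horizontal line, so there the
   overcrossing strand goes from i + 1 to i. *)
Definition over_in (N : nat) (x : letter N) : 'I_N :=
  if x.2 then posl x.1 else posr x.1.
Definition over_out (N : nat) (x : letter N) : 'I_N :=
  if x.2 then posr x.1 else posl x.1.
Definition under_in (N : nat) (x : letter N) : 'I_N := over_out x.
Definition under_out (N : nat) (x : letter N) : 'I_N := over_in x.

Definition follow_letter (N : nat) (x : letter N) (p : 'I_N) : 'I_N :=
  if p == over_in x then over_out x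
  else if p == under_in x then under_out x else p.

(* The top position of the strand of the braid that starts at [p]. *)
Definition follow (N : nat) (b : braid_word N) (p : 'I_N) : 'I_N :=
  foldl (fun q x => follow_letter x q) p b.

(* The interval components of a closed braid automatically join the bottom to
   the top, so the closure is a string link exactly if it has no closed
   component, i.e. if following the strands from any closed position one
   eventually leaves the closed positions. *)
Definition is_string_link (n m : nat) (b : braid_word (n + m)) : Prop :=
  forall p : 'I_(n + m), (n <= p)%N ->
    exists r : nat, (iter r (follow b) p < n)%N.

(** * The random walk invariant *)

(* [(l, p)] is the point at position [p] above the first [l] crossings. *)
Definition dpoint (n m : nat) (b : braid_word (n + m)) :=
  ('I_(size b).+1 * 'I_(n + m))%type.

Definition letter_step (N : nat) (x : letter N) (p q : 'I_N) : bool :=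
  if p == over_in x then (q == over_out x) || (q == under_out x)
  else if p == under_in x then q == under_out x
  else q == p.

Definition letter_weight (F : fieldType) (t : F) (N : nat) (x : letter N)
    (p q : 'I_N) : F :=
  let u := if x.2 then t else t^-1 in
  if p == over_in x then (if q == over_out x then u else 1 - u) else 1.

(* A step either goes up through one crossing level, or runs along a closing
   arc from the top back to the bottom. *)
Definition dstep (n m : nat) (b : braid_word (n + m)) (P Q : dpoint b) : bool :=
  if onth b P.1 is Some x
  then (Q.1 == P.1.+1 :> nat) && letter_step x P.2 Q.2
  else [&& (n <= P.2)%N, Q.1 == 0 :> nat & Q.2 == P.2].

Definition dstep_weight (F : fieldType) (t : F) (n m : nat)
    (b : braid_word (n + m)) (P Q : dpoint b) : F :=
  if onth b P.1 is Some x then letter_weight t x P.2 Q.2 else 1.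

Definition dbottom (n m : nat) (b : braid_word (n + m)) (i : 'I_n) : dpoint b :=
  (ord0, lshift m i).
Definition dtop (n m : nat) (b : braid_word (n + m)) (j : 'I_n) : dpoint b :=
  (ord_max, lshift m j).

(* A path is given by the list of the points visited after its start. *)
Definition admissible (n m : nat) (b : braid_word (n + m)) (i j : 'I_n) :
    set (seq (dpoint b)) :=
  [set P | path (@dstep n m b) (dbottom b i) P
           /\ last (dbottom b i) P = dtop b j].

Definition path_weight (F : fieldType) (t : F) (n m : nat)
    (b : braid_word (n + m)) (i : 'I_n) (P : seq (dpoint b)) : F :=
  \prod_(w <- pairmap (dstep_weight t (b:=b)) (dbottom b i) P) w.

Definition abs_sums_to (R : realType) (I : choiceType) (D : set I)
    (f : I -> R) (v : R) : Prop :=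
  summable D (EFin \o f) /\
  (\esum_(x in D) (EFin \o f)^\+ x - \esum_(x in D) (EFin \o f)^\- x = v%:E)%E.

Notation ratfrac := {fraction {poly rat}}.

(* [r] is the (j, i) entry: for all real t close to 1, the sum of the weights
   of the admissible paths from (i, 0) to (j, 1) is the value of r at t. *)
Definition is_rw_entry (R : realType) (n m : nat) (b : braid_word (n + m))
    (j i : 'I_n) (r : ratfrac) : Prop :=
  exists p q : {poly rat},
    [/\ q != 0, r = FracField.tofrac p / FracField.tofrac q
      & \forall t \near (1 : R),
          (map_poly ratr q).[t] != 0 /\
          abs_sums_to (@admissible n m b i j) (@path_weight R t n m b i)
            ((map_poly ratr p).[t] / (map_poly ratr q).[t])].

(* There is exactly one rational function as in [is_rw_entry] if the closure
   of [b] is a string link; in general the default value is 0. *)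
Definition rw (R : realType) (n m : nat) (b : braid_word (n + m)) :
    'M[ratfrac]_n :=
  \matrix_(j, i) xget 0 [set r | is_rw_entry R b j i r]%classic.

(* The field embedding of Q(t) in Q(s) with s ^ 2 = t, i.e. s = t ^ (1/2). *)
Definition sqrt_ext (r : ratfrac) : ratfrac :=
  FracField.tofrac ((repr r).1 \Po 'X^2) /
  FracField.tofrac ((repr r).2 \Po 'X^2).

(** * Exterior powers *)

Definition increasing (k n : nat) (f : {ffun 'I_k -> 'I_n}) : bool :=
  [forall a : 'I_k, forall b : 'I_k, (a < b)%N ==> (f a < f b)%N].

Definition inc_fun (k n : nat) := {f : {ffun 'I_k -> 'I_n} | increasing f}.

(* The exterior power of K ^ n, in its basis of the vectors
   e_(f 0) /\ ... /\ e_(f (k - 1)) with f increasing. *)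
Definition extpow (K : fieldType) (k n : nat) :=
  {ffun inc_fun k n -> K^o}.

Definition wedge (K : fieldType) (k n : nat) (x : 'I_k -> 'cV[K]_n) :
    extpow K k n :=
  [ffun f : inc_fun k n => \det (\matrix_(a < k, b < k) x b (val f a) 0) : K^o].

(* [extpow_map_wedge] below characterises this linear map. *)
Definition extpow_map (K : fieldType) (k n : nat) (A : 'M[K]_n)
    (v : extpow K k n) : extpow K k n :=
  \sum_(f : inc_fun k n) v f *: wedge (fun a => col (val f a) A).

Lemma increasingP (k n : nat) (f : {ffun 'I_k -> 'I_n}) :
  reflect (forall a b : 'I_k, (a < b)%N -> (f a < f b)%N) (increasing f).
Proof.
apply: (iffP forallP) => [H a b|H a]; first by move/forallP: (H a) => /(_ b)/implyP.
by apply/forallP => b; apply/implyP; exact: H.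
Qed.

Lemma increasing_inj (k n : nat) (f : {ffun 'I_k -> 'I_n}) :
  increasing f -> injective f.
Proof.
move=> /increasingP fi a b fab; apply/val_inj.
case: (ltngtP (val a) (val b)) => // /fi; by rewrite fab ltnn.
Qed.

Lemma increasing_endo_ge (k : nat) (u : 'I_k -> 'I_k) :
  (forall a b : 'I_k, (a < b)%N -> (u a < u b)%N) ->
  forall a : 'I_k, (a <= u a)%N.
Proof.
move=> ui [a ak]; elim: a ak => //= a IH ak.
have ak' : (a < k)%N by apply: ltnW.
apply: leq_ltn_trans (IH ak') _; exact: ui.
Qed.

Lemma inc_fun_perm_inj (k n : nat) :
  injective (fun fs : (inc_fun k n * {perm 'I_k})%type =>
    [ffun a => val fs.1 (fs.2 a)] : {ffun 'I_k -> 'I_n}).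
Proof.
have key (f g : inc_fun k n) (s r : {perm 'I_k}) :
    (forall a, val f (s a) = val g (r a)) -> forall a, (s a <= r a)%N.
  move=> E a; pose u (x : 'I_k) := r ((s^-1)%g x).
  have Eu x : val f x = val g (u x) by rewrite -[x in LHS](permKV s) E.
  have ui (x y : 'I_k) : (x < y)%N -> (u x < u y)%N.
    move=> xy; have := increasingP _ (valP f) _ _ xy; rewrite !Eu => guxy.
    rewrite ltnNge; apply/negP; rewrite leq_eqVlt => /orP[/eqP/val_inj e|].
      by move: guxy; rewrite e ltnn.
    by move=> /(increasingP _ (valP g)) /ltn_trans /(_ guxy); rewrite ltnn.
  by have := increasing_endo_ge ui (s a); rewrite /u permK.
move=> [f s] [g r] /ffunP E; have {}E a : val f (s a) = val g (r a).
  by have := E a; rewrite !ffunE.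
have sr : s = r.
  apply/permP => a; apply/val_inj/eqP; rewrite eqn_leq (key _ _ _ _ E) /=.
  by apply: (key g f) => x.
subst r; congr (_, _); apply/val_inj/ffunP => a.
by rewrite -[a](permKV s).
Qed.

Lemma inc_fun_perm_surj (k n : nat) (h : {ffun 'I_k -> 'I_n}) : injective h ->
  exists fs : (inc_fun k n * {perm 'I_k})%type, h = [ffun a => val fs.1 (fs.2 a)].
Proof.
move=> hi; pose r0 (a : 'I_k) := #|[pred b : 'I_k | (h b < h a)%N]|.
have r0lt (a b : 'I_k) : (h a < h b)%N -> (r0 a < r0 b)%N.
  move=> hab; apply: proper_card; apply/properP; split.
    by apply/fintype.subsetP => x; rewrite !inE => /ltn_trans; exact.
  by exists a; rewrite !inE ?ltnn.
have r0k a : (r0 a < k)%N.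
  rewrite -[X in (_ < X)%N](card_ord k); apply: proper_card; apply/properP.
  by split; [exact/fintype.subsetP | exists a; rewrite // inE ltnn].
pose r a := Ordinal (r0k a).
have ri : injective r.
  move=> a b /(congr1 val) /= e; apply: hi; apply: val_inj.
  by case: (ltngtP (val (h a)) (val (h b))) => // /r0lt; rewrite e ltnn.
pose s := perm ri; pose f := [ffun a => h ((s^-1)%g a)] : {ffun 'I_k -> 'I_n}.
have fi : increasing f.
  apply/increasingP => a b; rewrite !ffunE -{1}(permKV s a) -{1}(permKV s b).
  rewrite !(permE ri) /= => ab; rewrite ltnNge leq_eqVlt; apply/negP.
  case/orP=> [/eqP/val_inj/hi e|/r0lt]; first by move: ab; rewrite e ltnn.
  by move=> /ltn_trans /(_ ab); rewrite ltnn.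
by exists (exist _ f fi, s); apply/ffunP => a; rewrite !ffunE /= permK.
Qed.

Lemma extpow_map_wedge (K : fieldType) (k n : nat) (A : 'M[K]_n)
    (x : 'I_k -> 'cV[K]_n) :
  extpow_map A (wedge x) = wedge (fun a => A *m x a).
Proof.
apply/ffunP => g; rewrite /extpow_map sum_ffunE !ffunE.
pose G (h : {ffun 'I_k -> 'I_n}) : K :=
  (\prod_a A (val g a) (h a)) * \det (\matrix_(a < k, b < k) x b (h a) 0).
transitivity (\sum_h G h).
  rewrite (bigID (fun h : {ffun 'I_k -> 'I_n} => injectiveb h)) /=.
  rewrite [X in _ = _ + X]big1 ?addr0; last first.
    move=> h /injectivePn[a [b ab hab]]; rewrite /G.
    rewrite (determinant_alternate ab) ?mulr0 // => c.
    by rewrite !mxE hab.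
  pose c := fun fs : (inc_fun k n * {perm 'I_k})%type =>
    [ffun a => val fs.1 (fs.2 a)] : {ffun 'I_k -> 'I_n}.
  rewrite (eq_bigl (fun h => h \in imset c (mem predT))); last first.
    move=> h; apply/injectiveP/imsetP => [/inc_fun_perm_surj[fs ->]|[fs _ ->]].
      by exists fs.
    by move=> a b; rewrite !ffunE => /(increasing_inj (valP fs.1))/perm_inj.
  rewrite big_imset /=; last by move=> ? ? _ _; exact: inc_fun_perm_inj.
  rewrite -(pair_bigA _ (fun f s => G (c (f, s)))) /=; apply: eq_bigr => f _.
  rewrite !ffunE /GRing.scale /= mulrC.
  have -> : \det (\matrix_(a < k, b < k) (col (val f b) A) (val g a) 0) =
      \sum_(s : {perm 'I_k}) (-1) ^+ s * \prod_a A (val g a) (val f (s a)).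
    by apply: eq_bigr => s _; congr (_ * _); apply: eq_bigr => a _; rewrite !mxE.
  rewrite mulr_suml; apply: eq_bigr => s _; rewrite /G.
  have -> : \matrix_(a < k, b < k) x b (c (f, s) a) 0 =
      row_perm s (\matrix_(a < k, b < k) x b (val f a) 0).
    by apply/matrixP => a b; rewrite !mxE ffunE.
  rewrite row_permE det_mulmx det_perm -!mulrA mulrCA; congr (_ * (_ * _)).
  by apply: eq_bigr => a _; rewrite ffunE.
pose F (s : {perm 'I_k}) (a : 'I_k) i := A (val g a) i * x (s a) i 0.
transitivity (\sum_(s : {perm 'I_k}) (-1) ^+ s * \prod_a \sum_i F s a i);
    last first.
  by apply: eq_bigr => s _; congr (_ * _); apply: eq_bigr => a _; rewrite !mxE.
under [RHS]eq_bigr do rewrite bigA_distr_bigA /= mulr_sumr.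
rewrite exchange_big /=; apply: eq_bigr => h _; rewrite /G mulr_sumr.
apply: eq_bigr => s _; rewrite mulrCA big_split /=; congr (_ * (_ * _)).
by apply: eq_bigr => a _; rewrite mxE.
Qed.

(** * Ohtsuki's functor *)

(* In all of this part [s] stands for t ^ (1/2), and scalars are extended to
   a field [K] containing it. A state [f : state N] is the basis vector
   e_(f 0) (x) ... (x) e_(f (N - 1)) of the N-th tensor power of V. *)
Definition state (N : nat) := {ffun 'I_N -> bool}.
Definition tensor (K : fieldType) (N : nat) := {ffun state N -> K^o}.

Definition basis_vec (K : fieldType) (N : nat) (f : state N) : tensor K N :=
  [ffun g => (g == f)%:R].

(* The endomorphism with matrix entries [M g f]; [f] indexes the columns. *)
Definition endo_of (K : fieldType) (N : nat) (M : state N -> state N -> K) :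
    'End(tensor K N) :=
  linfun (fun v : tensor K N => [ffun g => \sum_f M g f * v f] : tensor K N).

(* The coefficient of e_c (x) e_d in R(e_a (x) e_b). *)
Definition Rcoef (K : fieldType) (s : K) (c d a b : bool) : K :=
  match a, b with
  | false, false => s^-1 *+ (~~ c && ~~ d)
  | false, true  => 1 *+ (c && ~~ d)
  | true,  false => 1 *+ (~~ c && d) + (s^-1 - s) *+ (c && ~~ d)
  | true,  true  => - s *+ (c && d)
  end.

Definition V_gen (K : fieldType) (s : K) (N : nat) (i : 'I_N.-1) :
    'End(tensor K N) :=
  endo_of (fun g f =>
    if [forall p, (p != posl i) && (p != posr i) ==> (g p == f p)]
    then Rcoef s (g (posl i)) (g (posr i)) (f (posl i)) (f (posr i))
    else 0).

Definition V_letter (K : fieldType) (s : K) (N : nat) (x : letter N) :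
    'End(tensor K N) :=
  if x.2 then V_gen s x.1 else (V_gen s x.1)^-1%VF.

Definition V_braid (K : fieldType) (s : K) (N : nat) (b : braid_word N) :
    'End(tensor K N) :=
  foldl (fun g x => (V_letter s x \o g)%VF) \1%VF b.

Definition cat_state (n m : nat) (f : state n) (c : state m) : state (n + m) :=
  [ffun p : 'I_(n + m) => match fintype.split p with inl i => f i | inr j => c j end].

(* The eigenvalue of the m-th tensor power of h = s diag(1, -1) at [c]. *)
Definition hweight (K : fieldType) (s : K) (m : nat) (c : state m) : K :=
  \prod_j (s * (-1) ^+ c j).

(* id (x) Tr_m. *)
Definition partial_trace (K : fieldType) (s : K) (n m : nat)
    (g : 'End(tensor K (n + m))) : 'End(tensor K n) :=
  endo_of (fun f' f =>
    \sum_(c : state m)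
      hweight s c * g (basis_vec K (cat_state f c)) (cat_state f' c)).

Definition V_tangle (K : fieldType) (s : K) (n m : nat)
    (b : braid_word (n + m)) : 'End(tensor K n) :=
  partial_trace s (V_braid s b).

Definition Wspace (K : fieldType) (n k : nat) : {vspace tensor K n} :=
  <<[seq basis_vec K f | f : state n <- enum (state n) & #|[pred i | f i]| == k]>>%VS.

(* [V_tangle s b] preserves [Wspace K n k], so the projection does nothing. *)
Definition W_map (K : fieldType) (s : K) (n k m : nat)
    (b : braid_word (n + m)) (w : subvs_of (Wspace K n k)) : subvs_of (Wspace K n k) :=
  vsproj (Wspace K n k) (V_tangle s b (vsval w)).

(* [Wspace K n 0] is the line spanned by the constant state 0. *)
Definition W0 (K : fieldType) (s : K) (n m : nat) (b : braid_word (n + m)) : K :=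
  V_tangle s b (basis_vec K [ffun=> false]) [ffun=> false].

Definition W_over0 (K : fieldType) (s : K) (n k m : nat)
    (b : braid_word (n + m)) (w : subvs_of (Wspace K n k)) : subvs_of (Wspace K n k) :=
  (W0 s b)^-1 *: W_map s b w.

Definition sqrt_t : ratfrac := FracField.tofrac 'X.

(* Main.v *)
From HB Require Import structures.
Require Import Defs.
From mathcomp Require Import all_boot all_order all_algebra perm.
From mathcomp Require Import generic_quotient.
From mathcomp Require Import all_classical all_reals all_analysis.
From mathcomp Require Import ring zify.

(** Both sides are governed by the Burau matrix M of the braid b that presents
   the string link: its (q, p) entry is the total weight of the ways to climb
   once through b from position p to position q. Let A, B, C, D be its blocks
   for the n open and the m closed positions, D being the one from closed to
   closed positions, and let closure_mx M = A + B (1 - D)^-1 C. Both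
   representations turn out to be the k-th exterior power of closure_mx M.

   Random walk. A walk that runs along closing arcs r > 0 times contributes to
   B D^(r - 1) C, so that the sum over all walks is closure_mx M as soon as it
   converges absolutely. At t = 1 a walk follows a strand of the braid, and in
   a string link every strand starting in a closed position leaves the closed
   positions after finitely many turns. One plus the number of these turns is
   a potential that every turn decreases at t = 1; by continuity it stays
   superharmonic for the absolute values of the weights near t = 1
   (near_potential), which bounds the absolute sums (walks_summable). The sums
   then satisfy the first-step equations (walk_sum_step), which are solved by
   closure_mx M (path_sum_bottom). A rational function is determined by its
   values near 1, which gives rw_closure.

   Ohtsuki's functor. Read a state as the wedge of the positions where it is 1.
   Up to a rescaling of the generators by powers of s and a global power of s,
   the map R is the automorphism of the exterior algebra induced by M. Instead
   of computing minors one multiplies by one vector at a time: if a(x) is the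
   left multiplication by the vector x, then V(b) a(x) = a(M x) V(b)
   (braid_create_vec). The partial trace weighted by h is, up to a power of s,
   a partial supertrace, and by graded cyclicity a factor a(y) with y
   supported on the closed positions may be moved around the closure
   (supertrace_cyclic). For y = (1 - D)^-1 C x the matrix M sends x + y to
   closure_mx M x + y, the terms with y cancel, and
   V(T) a(x) = a(closure_mx M x) V(T) (tangle_create_vec). As V(T) multiplies
   the vacuum by W0, it sends the wedge of x_1, ..., x_k to W0 times the wedge
   of the vectors closure_mx M x_i (tangle_creates). The isomorphism is the
   diagonal map Wcoord, which undoes the rescaling.

   It remains to see that det (1 - D) and W0 do not vanish. Both are regular at
   s = 1, where b permutes the positions, and permutes the states up to sign;
   their values there are nonzero because no strand of a string link stays in
   the closed positions for ever (string_link_det1, string_link_W01). *)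

Set Implicit Arguments.
Unset Strict Implicit.
Unset Printing Implicit Defensive.

Import Order.TTheory GRing.Theory Num.Theory.
Import numFieldNormedType.Exports.

Local Open Scope ring_scope.

(** * The generators as operators on states *)

Lemma endo_ofE (K : fieldType) (N : nat) (M : state N -> state N -> K)
  (v : tensor K N) (g : state N) : endo_of M v g = \sum_f M g f * v f.
Proof.
pose L (v : tensor K N) : tensor K N := [ffun g => \sum_f M g f * v f].
have Llin : linear L.
  move=> a u w; apply/ffunP => h; rewrite !ffunE /GRing.scale /= mulr_sumr -big_split /=.
  by apply: eq_bigr => f _; rewrite !ffunE /GRing.scale /=; ring.
pose L' : {linear tensor K N -> tensor K N} :=
  HB.pack L (GRing.isLinear.Build _ _ _ _ L Llin).
by rewrite /endo_of -/L (lfunE L') /= ffunE.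
Qed.

Lemma posl_neq_posr (N : nat) (i : 'I_N.-1) : posl i != posr i.
Proof. by rewrite -val_eqE /= neq_ltn ltnSn. Qed.

Definition swap_state (N : nat) (i : 'I_N.-1) (g : state N) : state N :=
  [ffun p => g (tperm (posl i) (posr i) p)].

Lemma swap_stateK (N : nat) (i : 'I_N.-1) : involutive (swap_state i).
Proof. by move=> g; apply/ffunP => p; rewrite !ffunE tpermK. Qed.

Lemma swap_state_posl (N : nat) (i : 'I_N.-1) g :
  swap_state i g (posl i) = g (posr i).
Proof. by rewrite ffunE tpermL. Qed.

Lemma swap_state_posr (N : nat) (i : 'I_N.-1) g :
  swap_state i g (posr i) = g (posl i).
Proof. by rewrite ffunE tpermR. Qed.

Lemma swap_state_id (N : nat) (i : 'I_N.-1) (g : state N) :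
  g (posl i) = g (posr i) -> swap_state i g = g.
Proof. by move=> e; apply/ffunP => p; rewrite ffunE; case: tpermP => // ->. Qed.

(** The matrix R preserves the number of ones among its two factors, so the
   sum over states defining V_gen reduces to g and its swap. *)
Lemma V_genE (K : fieldType) (s : K) (N : nat) (i : 'I_N.-1)
    (v : tensor K N) (g : state N) :
  V_gen s i v g =
  if g (posl i) == g (posr i)
  then (if g (posl i) then - s else s^-1) * v g
  else v (swap_state i g) + (if g (posl i) then (s^-1 - s) * v g else 0).
Proof.
rewrite endo_ofE.
have offg (f : state N) : [forall p, (p != posl i) && (p != posr i) ==> (g p == f p)] ->
    g (posl i) = f (posl i) -> g (posr i) = f (posr i) -> f = g.
  move=> /forallP H e1 e2; apply/ffunP => p; move: (H p).
  case: (altP (p =P posl i)) => [-> //|_]; case: (altP (p =P posr i)) => [-> //|_].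
  by move=> /eqP.
have ong : [forall p, (p != posl i) && (p != posr i) ==> (g p == g p)].
  by apply/forallP => p; rewrite eqxx implybT.
have offs (f : state N) : [forall p, (p != posl i) && (p != posr i) ==> (g p == f p)] ->
    g (posl i) = f (posr i) -> g (posr i) = f (posl i) -> f = swap_state i g.
  move=> /forallP H e1 e2; apply/(@ffunP _ (fun=> bool)) => p; move: (H p); rewrite ffunE.
  case: tpermP => [->|->|/eqP -> /eqP ->]; rewrite ?e1 ?e2 //.
  by move=> /eqP.
have ons : [forall p, (p != posl i) && (p != posr i) ==> (g p == swap_state i g p)].
  apply/forallP => p; rewrite ffunE; case: tpermP => [->|->|_ _]; rewrite ?eqxx ?andbF //=.
  by rewrite implybT.
case: ifP => [/eqP e|ne].
  rewrite (bigD1 g) //= ong big1 ?addr0; last first.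
    move=> f fg; case: ifP => [H|_]; last by rewrite mul0r.
    move: (offg f H) fg; rewrite e.
    by case: (g (posr i)); case: (f (posl i)); case: (f (posr i)) => /= E;
      rewrite ?mulr0n ?mul0r ?addr0 ?mul0r // E ?eqxx.
  by rewrite e; case: (g (posr i)); rewrite /= ?mulr1n.
have sg : swap_state i g != g.
  apply/eqP => /(congr1 (fun h : state N => h (posl i))).
  by rewrite swap_state_posl => e; rewrite e eqxx in ne.
rewrite (bigD1 (swap_state i g)) //= ons (bigD1 g) /=; last by rewrite eq_sym.
rewrite ong big1 ?addr0; last first.
  move=> f /andP[fs fg]; case: ifP => [H|_]; last by rewrite mul0r.
  move: (offg f H) (offs f H) fg fs ne.
  case: (g (posl i)); case: (g (posr i)); case: (f (posl i)); case: (f (posr i)) => E1 E2;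
    by [rewrite E1 ?eqxx | rewrite E2 ?eqxx | rewrite /= ?mulr0n ?addr0 ?mul0r].
rewrite swap_state_posl swap_state_posr; move: ne.
by case: (g (posl i)); case: (g (posr i)) => // _; rewrite /= ?mulr0n ?mulr1n ?addr0 ?add0r ?mul1r ?mul0r ?addr0.
Qed.

(** The skein relation of the Alexander polynomial; it makes the inverse of a
   generator explicit. *)
Lemma V_gen_quadratic (K : fieldType) (s : K) (s0 : s != 0) (N : nat)
    (i : 'I_N.-1) (v : tensor K N) :
  V_gen s i (V_gen s i v) = (s^-1 - s) *: V_gen s i v + v.
Proof.
apply/ffunP => g; rewrite !ffunE /GRing.scale /= !V_genE swap_state_posl.
rewrite swap_state_posr swap_stateK [g (posr i) == _]eq_sym.
by case: (g (posl i)); case: (g (posr i)) => //=; field.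
Qed.

Lemma V_gen_inv (K : fieldType) (s : K) (s0 : s != 0) (N : nat)
    (i : 'I_N.-1) (v : tensor K N) :
  (V_gen s i)^-1%VF v = V_gen s i v - (s^-1 - s) *: v.
Proof.
have inj : lker (V_gen s i) == 0%VS.
  rewrite lker0_lfunE // || apply/lker0P => u w e.
  have := V_gen_quadratic s0 i u; rewrite e V_gen_quadratic //.
  by move/addrI.
apply: (canLR (lker0_lfunK inj)).
by rewrite linearB linearZ /= V_gen_quadratic // addrC addKr.
Qed.

(** * Burau matrices and creation operators *)

Lemma tensorD (K : fieldType) (N : nat) (u v : tensor K N) g :
  (u + v) g = u g + v g.
Proof. by rewrite ffunE. Qed.

Lemma tensorZ (K : fieldType) (N : nat) (a : K) (v : tensor K N) g :
  (a *: v) g = a * v g.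
Proof. by rewrite ffunE. Qed.

Definition letter_mx (F : fieldType) (t : F) (N : nat) (x : letter N) : 'M[F]_N :=
  \matrix_(q, p) (letter_weight t x p q *+ letter_step x p q).

(** Columns are indexed by the start and rows by the end of a climb, so that
   letters higher up in the braid multiply on the left. *)
Definition burau (F : fieldType) (t : F) (N : nat) (b : braid_word N) : 'M[F]_N :=
  foldl (fun M x => letter_mx t x *m M) 1%:M b.

Definition remove (N : nat) (p : 'I_N) (g : state N) : state N :=
  [ffun q => (q != p) && g q].

Definition before (N : nat) (p : 'I_N) (g : state N) : nat :=
  \sum_(q < N | (q < p)%N) g q.

(** Left exterior multiplication by the p-th generator, a state being read as
   the wedge, in increasing order, of the positions where it is 1. Rescaling
   the p-th generator by a power of s turns the off-diagonal coefficients 1, 1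
   of R into the weights t, 1 of the random walk, up to a common factor. *)
Definition create (K : fieldType) (s : K) (N : nat) (p : 'I_N)
    (v : tensor K N) : tensor K N :=
  [ffun g => (s^-1 ^+ p * (-1) ^+ before p g * v (remove p g)) *+ g p].

Definition create_vec (K : fieldType) (s : K) (N : nat) (x : 'cV[K]_N)
    (v : tensor K N) : tensor K N :=
  \sum_p x p 0 *: create s p v.

Lemma create_is_linear (K : fieldType) (s : K) (N : nat) (p : 'I_N) :
  linear (@create K s N p).
Proof.
move=> a u v; apply/ffunP => g; rewrite !ffunE /GRing.scale /= mulrnAr -mulrnDl.
by congr (_ *+ _); ring.
Qed.

HB.instance Definition _ (K : fieldType) (s : K) (N : nat) (p : 'I_N) :=
  GRing.isLinear.Build K (tensor K N) (tensor K N) _ (@create K s N p)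
    (create_is_linear s p).

Lemma create_vecE (K : fieldType) (s : K) (N : nat) x (v : tensor K N) g :
  create_vec s x v g = \sum_p x p 0 * create s p v g.
Proof. by rewrite sum_ffunE; apply: eq_bigr => p _; rewrite ffunE. Qed.

Lemma create_vec_is_linear (K : fieldType) (s : K) (N : nat) (x : 'cV[K]_N) :
  linear (@create_vec K s N x).
Proof.
move=> a u v; rewrite scaler_sumr -big_split; apply: eq_bigr => p _ /=.
by rewrite linearP scalerDr !scalerA mulrC.
Qed.

HB.instance Definition _ (K : fieldType) (s : K) (N : nat) (x : 'cV[K]_N) :=
  GRing.isLinear.Build K (tensor K N) (tensor K N) _ (@create_vec K s N x)
    (create_vec_is_linear s x).

Lemma create_vecD (K : fieldType) (s : K) (N : nat) (x y : 'cV[K]_N) v :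
  create_vec s (x + y) v = create_vec s x v + create_vec s y v.
Proof.
by rewrite -big_split; apply: eq_bigr => p _; rewrite mxE scalerDl.
Qed.

Lemma create_vec_col (K : fieldType) (s : K) (N : nat) (M : 'M[K]_N) x v :
  create_vec s (M *m x) v = \sum_p x p 0 *: create_vec s (col p M) v.
Proof.
under [RHS]eq_bigr do rewrite scaler_sumr.
rewrite exchange_big; apply: eq_bigr => q _ /=.
rewrite mxE scaler_suml; apply: eq_bigr => p _.
by rewrite !mxE scalerA mulrC.
Qed.

Lemma create_col (K : fieldType) (s : K) (N : nat) p (v : tensor K N) :
  create_vec s (delta_mx p 0) v = create s p v.
Proof.
rewrite /create_vec (bigD1 p) //= big1 ?addr0 => [|q qp]; rewrite mxE.
  by rewrite !eqxx scale1r.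
by rewrite (negbTE qp) scale0r.
Qed.

Lemma before_swap (N : nat) (i : 'I_N.-1) (p : 'I_N) (g : state N) :
  p != posl i -> p != posr i -> before p (swap_state i g) = before p g.
Proof.
move=> pl pr; rewrite /before.
rewrite (reindex_inj (@perm_inj _ (tperm (posl i) (posr i)))) /=.
apply: eq_big => [q|q _]; last by rewrite ffunE tpermK.
have pl' : (p <> i :> nat) by move=> e; move/eqP: pl; apply; apply: val_inj.
have pr' : (p <> i.+1 :> nat) by move=> e; move/eqP: pr; apply; apply: val_inj.
by case: tpermP => [->|->|//] /=; lia.
Qed.

Lemma before_posr (N : nat) (i : 'I_N.-1) (g : state N) :
  before (posr i) g = (before (posl i) g + g (posl i))%N.
Proof.
rewrite /before (bigD1 (posl i)) //= addnC; congr (_ + _)%N.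
apply: eq_bigl => q; rewrite -val_eqE /=; lia.
Qed.

Lemma remove_swap (N : nat) (i : 'I_N.-1) (p : 'I_N) (g : state N) :
  p != posl i -> p != posr i ->
  remove p (swap_state i g) = swap_state i (remove p g).
Proof.
move=> pl pr; apply/(@ffunP _ (fun=> bool)) => q; rewrite !ffunE.
case: tpermP => [->|->|//]; rewrite ![_ == p]eq_sym ?(negbTE pl) ?(negbTE pr) //.
Qed.

Lemma before_remove (N : nat) (p q : 'I_N) (g : state N) :
  (p <= q)%N -> before p (remove q g) = before p g.
Proof.
move=> pq; apply: eq_bigr => j jp; rewrite ffunE -val_eqE.
by rewrite neq_ltn (leq_trans jp pq).
Qed.

Lemma create_comm_gen (K : fieldType) (s : K) (N : nat) (i : 'I_N.-1)
    (p : 'I_N) (v : tensor K N) : p != posl i -> p != posr i ->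
  V_gen s i (create s p v) = create s p (V_gen s i v).
Proof.
move=> pl pr; apply/ffunP => g; rewrite V_genE [RHS]ffunE V_genE ![create _ _ _ _]ffunE.
rewrite before_swap // remove_swap // [remove p g (posl i)]ffunE [remove p g (posr i)]ffunE.
rewrite ![_ == p]eq_sym pl pr /=.
have -> : swap_state i g p = g p by rewrite ffunE tpermD // eq_sym.
by case: (g p); case: eqP => _; case: (g (posl i)); rewrite ?mulr0n ?mulr1n ?mulr0 ?addr0 //; ring.
Qed.

Lemma remove_posl_swap (N : nat) (i : 'I_N.-1) (g : state N) : ~~ g (posl i) ->
  remove (posl i) (swap_state i g) = remove (posr i) g.
Proof.
move=> /negbTE gl; apply/(@ffunP _ (fun=> bool)) => q; rewrite !ffunE.
case: tpermP => [->|->|/eqP/negbTE -> /eqP/negbTE -> //].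
  by rewrite eqxx gl andbF.
by rewrite eqxx gl andbF.
Qed.

Lemma remove_posr_swap (N : nat) (i : 'I_N.-1) (g : state N) : ~~ g (posr i) ->
  remove (posr i) (swap_state i g) = remove (posl i) g.
Proof.
move=> /negbTE gl; apply/(@ffunP _ (fun=> bool)) => q; rewrite !ffunE.
case: tpermP => [->|->|/eqP/negbTE -> /eqP/negbTE -> //].
  by rewrite eqxx gl andbF.
by rewrite eqxx gl andbF.
Qed.

Lemma swap_remove_posl (N : nat) (i : 'I_N.-1) (g : state N) : g (posr i) = g (posl i) ->
  swap_state i (remove (posl i) g) = remove (posr i) g.
Proof.
move=> gl; apply/(@ffunP _ (fun=> bool)) => q; rewrite !ffunE.
have ne := negbTE (posl_neq_posr i).
case: tpermP => [->|->|/eqP/negbTE -> /eqP/negbTE -> //].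
  by rewrite eq_sym ne gl.
by rewrite !eqxx.
Qed.

Lemma swap_remove_posr (N : nat) (i : 'I_N.-1) (g : state N) : g (posr i) = g (posl i) ->
  swap_state i (remove (posr i) g) = remove (posl i) g.
Proof. by move=> e; rewrite -swap_remove_posl // swap_stateK. Qed.

Lemma before_posl_swap (N : nat) (i : 'I_N.-1) (g : state N) :
  before (posl i) (swap_state i g) = before (posl i) g.
Proof.
apply: eq_bigr => q qi; rewrite ffunE tpermD // -val_eqE /= neq_ltn.
  by rewrite qi orbT.
by rewrite ltnS (ltnW qi) orbT.
Qed.

Lemma createE (K : fieldType) (s : K) (N : nat) p (v : tensor K N) g :
  create s p v g = (s^-1 ^+ p * (-1) ^+ before p g * v (remove p g)) *+ g p.
Proof. by rewrite ffunE. Qed.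

Lemma removeE (N : nat) (p q : 'I_N) (g : state N) :
  remove p g q = (q != p) && g q.
Proof. by rewrite ffunE. Qed.

(** On the two positions of the crossing R is the algebra map induced by a
   2 x 2 Burau block, and hence carries multiplication by a generator to
   multiplication by a column of that block. Only the four possible values of
   a state at these positions need to be compared. *)
Lemma gen_create_posl (K : fieldType) (s : K) (s0 : s != 0) (N : nat)
    (i : 'I_N.-1) (v : tensor K N) :
  V_gen s i (create s (posl i) v) =
  (1 - s ^+ 2) *: create s (posl i) (V_gen s i v)
  + s ^+ 2 *: create s (posr i) (V_gen s i v).
Proof.
apply/ffunP => g; have ne := negbTE (posl_neq_posr i).
have ne' : (posr i == posl i) = false by rewrite eq_sym ne.
rewrite V_genE tensorD !tensorZ !createE !V_genE !removeE.
rewrite !swap_state_posl !eqxx ?ne ?ne' /= !before_posr !before_posl_swap.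
have := @remove_posl_swap _ i g; have := @swap_remove_posl _ i g.
have := @swap_remove_posr _ i g.
have := swap_state_id (i := i) (g := remove (posl i) g).
have := swap_state_id (i := i) (g := remove (posr i) g).
rewrite !removeE !eqxx ?ne ?ne' /= [s^-1 ^+ i.+1]exprSr exprD.
move: (s^-1 ^+ i) => a.
case gl: (g (posl i)); case gr: (g (posr i)) => /= H1 H2 H3 H4 H5;
  try rewrite !(H1 erefl); try rewrite !(H2 erefl); try rewrite !(H3 erefl);
  try rewrite !(H4 erefl); try rewrite !(H5 isT);
  rewrite ?mulr0n ?mulr1n /= ?expr0 ?expr1 ?mulr1; by [ring|field].
Qed.

Lemma gen_create_posr (K : fieldType) (s : K) (s0 : s != 0) (N : nat)
    (i : 'I_N.-1) (v : tensor K N) :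
  V_gen s i (create s (posr i) v) = create s (posl i) (V_gen s i v).
Proof.
apply/ffunP => g; have ne := negbTE (posl_neq_posr i).
have ne' : (posr i == posl i) = false by rewrite eq_sym ne.
rewrite V_genE !createE !V_genE !removeE.
rewrite !swap_state_posr !eqxx ?ne ?ne' /= !before_posr !before_posl_swap.
have := @remove_posr_swap _ i g; have := @swap_remove_posl _ i g.
have := @swap_remove_posr _ i g.
have := swap_state_id (i := i) (g := remove (posl i) g).
have := swap_state_id (i := i) (g := remove (posr i) g).
rewrite !removeE !eqxx ?ne ?ne' /= [s^-1 ^+ i.+1]exprSr !exprD swap_state_posl.
move: (s^-1 ^+ i) => a.
case gl: (g (posl i)); case gr: (g (posr i)) => /= H1 H2 H3 H4 H5;
  try rewrite !(H1 erefl); try rewrite !(H2 erefl); try rewrite !(H3 erefl);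
  try rewrite !(H4 erefl); try rewrite !(H5 isT);
  rewrite ?mulr0n ?mulr1n /= ?expr0 ?expr1 ?mulr1; by [ring|field].
Qed.

Lemma create_vecZ (K : fieldType) (s : K) (N : nat) a (y : 'cV[K]_N) v :
  create_vec s (a *: y) v = a *: create_vec s y v.
Proof.
by rewrite scaler_sumr; apply: eq_bigr => p _; rewrite mxE scalerA.
Qed.

Lemma gen_create (K : fieldType) (s : K) (s0 : s != 0) (N : nat)
    (i : 'I_N.-1) (p : 'I_N) (v : tensor K N) :
  V_gen s i (create s p v) =
  create_vec s (col p (letter_mx (s ^+ 2) (i, true))) (V_gen s i v).
Proof.
have ne := negbTE (posl_neq_posr i).
have ne' : (posr i == posl i) = false by rewrite eq_sym ne.
have [->|pl] := eqVneq p (posl i).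
  have -> : col (posl i) (letter_mx (s ^+ 2) (i, true)) =
      (1 - s ^+ 2) *: delta_mx (posl i) 0 + s ^+ 2 *: delta_mx (posr i) 0.
    apply/colP => q; rewrite !mxE /letter_weight /letter_step /over_in /over_out /under_out /= !eqxx !andbT.
    rewrite /over_in /=.
    case: (eqVneq q (posl i)) => [->|_]; rewrite ?ne ?mulr1n ?mulr1 ?mulr0 ?addr0 //=.
    by case: eqP => _; rewrite ?mulr1n ?mulr0n ?mulr0 ?add0r ?addr0 ?mulr1.
  by rewrite gen_create_posl // create_vecD !create_vecZ !create_col.
have [->|pr] := eqVneq p (posr i).
  have -> : col (posr i) (letter_mx (s ^+ 2) (i, true)) = delta_mx (posl i) 0.
    apply/colP => q; rewrite !mxE /letter_weight /letter_step /under_in /over_in /over_out /under_out /=.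
    by rewrite ne' eqxx andbT.
  by rewrite gen_create_posr // !create_col.
have -> : col p (letter_mx (s ^+ 2) (i, true)) = delta_mx p 0.
  apply/colP => q; rewrite !mxE /letter_weight /letter_step /under_in /over_in /over_out /under_out /=.
  by rewrite (negbTE pl) (negbTE pr) andbT.
by rewrite create_comm_gen // !create_col.
Qed.

Lemma gen_create_vec (K : fieldType) (s : K) (s0 : s != 0) (N : nat)
    (i : 'I_N.-1) (x : 'cV[K]_N) (v : tensor K N) :
  V_gen s i (create_vec s x v) =
  create_vec s (letter_mx (s ^+ 2) (i, true) *m x) (V_gen s i v).
Proof.
rewrite create_vec_col linear_sum; apply: eq_bigr => p _ /=.
by rewrite linearZ /= gen_create.
Qed.

Lemma letter_mxK (K : fieldType) (t : K) (t0 : t != 0) (N : nat) (i : 'I_N.-1) :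
  letter_mx t (i, true) *m letter_mx t (i, false) = 1%:M.
Proof.
have ne := negbTE (posl_neq_posr i).
have ne' : (posr i == posl i) = false by rewrite eq_sym ne.
apply/matrixP => q p; rewrite !mxE.
under eq_bigr do rewrite !mxE.
rewrite (bigD1 (posl i)) // (bigD1 (posr i)) //=; last by rewrite ne'.
rewrite /letter_weight /letter_step /under_in /over_in /over_out /under_out /over_in /=.
rewrite !eqxx ne ne'.
have [->|pr] := eqVneq p (posr i).
  rewrite big1 => [|r /andP[rl rr]]; last by rewrite (negbTE rl) (negbTE rr) /= mulr0.
  case: (eqVneq q (posl i)) => [->|ql]; rewrite ?ne ?ne' ?eqxx /=.
    rewrite !mulr1n; field.
    done.
  by case: eqP => _; rewrite /= ?mulr0n ?mulr1n; field.
have [->|pl] := eqVneq p (posl i).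
  rewrite big1 => [|r /andP[rl rr]]; last by rewrite (negbTE rr) /= mulr0.
  by rewrite ?mulr0n mulr0 addr0 !mulr1 add0r.
rewrite /= ?mulr0n !mulr0 !add0r.
rewrite (bigD1 p) /= ?pl ?pr // big1 ?addr0; last first.
  by move=> r /andP[_ rp]; rewrite (negbTE rp) mulr0.
by rewrite (negbTE pl) (negbTE pr) eqxx mulr1.
Qed.

Lemma V_genK (K : fieldType) (s : K) (s0 : s != 0) (N : nat)
    (i : 'I_N.-1) (v : tensor K N) :
  V_gen s i ((V_gen s i)^-1%VF v) = v.
Proof.
by rewrite V_gen_inv // linearB linearZ /= V_gen_quadratic // addrC addKr.
Qed.

Lemma V_gen_invK (K : fieldType) (s : K) (s0 : s != 0) (N : nat)
    (i : 'I_N.-1) (v : tensor K N) :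
  (V_gen s i)^-1%VF (V_gen s i v) = v.
Proof. by rewrite V_gen_inv // V_gen_quadratic // addrC addKr. Qed.

(** For an inverse letter the relation is that of the generator, transported
   along the inverses on both sides. *)
Lemma letter_create_vec (K : fieldType) (s : K) (s0 : s != 0) (N : nat)
    (y : letter N) (x : 'cV[K]_N) (v : tensor K N) :
  V_letter s y (create_vec s x v) =
  create_vec s (letter_mx (s ^+ 2) y *m x) (V_letter s y v).
Proof.
case: y => i [] ; rewrite /V_letter /=; first exact: gen_create_vec.
rewrite -{1}(mul1mx x) -(letter_mxK (expf_neq0 2 s0) i) -mulmxA.
by rewrite -{1}(V_genK s0 i v) -gen_create_vec // V_gen_invK.
Qed.

Lemma V_braid_rcons (K : fieldType) (s : K) (N : nat) (b : braid_word N) y v :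
  V_braid s (rcons b y) v = V_letter s y (V_braid s b v).
Proof. by rewrite /V_braid foldl_rcons lfunE. Qed.

Lemma V_braid_nil (K : fieldType) (s : K) (N : nat) v :
  V_braid s ([::] : braid_word N) v = v.
Proof. by rewrite /V_braid /= lfunE. Qed.

Lemma burau_rcons (F : fieldType) (t : F) (N : nat) (b : braid_word N) y :
  burau t (rcons b y) = letter_mx t y *m burau t b.
Proof. exact: foldl_rcons. Qed.

(** This relation determines V_braid up to its value on the vacuum, and takes
   the place of all computations with minors of the Burau matrix. *)
Theorem braid_create_vec (K : fieldType) (s : K) (s0 : s != 0) (N : nat)
    (b : braid_word N) (x : 'cV[K]_N) (v : tensor K N) :
  V_braid s b (create_vec s x v) =
  create_vec s (burau (s ^+ 2) b *m x) (V_braid s b v).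
Proof.
elim/last_ind: b => [|b y IH]; first by rewrite !V_braid_nil mul1mx.
by rewrite !V_braid_rcons IH letter_create_vec // burau_rcons mulmxA.
Qed.

Definition weight (N : nat) (g : state N) : nat := #|[pred i | g i]|.

(** Diagonal operators that see only the grading; the parity and the
   projections to the graded parts are of this form. *)
Definition weight_op (K : fieldType) (chi : nat -> K) (N : nat)
    (v : tensor K N) : tensor K N := [ffun g => chi (weight g) * v g].

Lemma weight_swap (N : nat) (i : 'I_N.-1) (g : state N) :
  weight (swap_state i g) = weight g.
Proof.
rewrite /weight -!sum1_card (reindex_inj (@perm_inj _ (tperm (posl i) (posr i)))) /=.
by apply: eq_bigl => q; rewrite !inE ffunE tpermK.
Qed.

Lemma gen_weight_op (K : fieldType) (s : K) (N : nat) (i : 'I_N.-1)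
    (chi : nat -> K) (v : tensor K N) :
  V_gen s i (weight_op chi v) = weight_op chi (V_gen s i v).
Proof.
apply/ffunP => g; rewrite V_genE [RHS]ffunE V_genE ![weight_op _ _ _]ffunE weight_swap.
by case: eqP => _; case: (g (posl i)); ring.
Qed.

Lemma braid_weight_op (K : fieldType) (s : K) (s0 : s != 0) (N : nat)
    (b : braid_word N) (chi : nat -> K) (v : tensor K N) :
  V_braid s b (weight_op chi v) = weight_op chi (V_braid s b v).
Proof.
elim/last_ind: b => [|b [i e] IH]; first by rewrite !V_braid_nil.
rewrite !V_braid_rcons IH; case: e; rewrite /V_letter /=; first exact: gen_weight_op.
by rewrite -{1}(V_genK s0 i (V_braid s b v)) -gen_weight_op V_gen_invK.
Qed.

(** * Closing strands by a supertrace *)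

Definition lstate (n m : nat) (g : state (n + m)) : state n :=
  [ffun i => g (lshift m i)].
Definition rstate (n m : nat) (g : state (n + m)) : state m :=
  [ffun j => g (rshift n j)].

Lemma cat_state_lshift (n m : nat) (f : state n) (c : state m) i :
  cat_state f c (lshift m i) = f i.
Proof. by rewrite ffunE (unsplitK (inl i)). Qed.

Lemma cat_state_rshift (n m : nat) (f : state n) (c : state m) j :
  cat_state f c (rshift n j) = c j.
Proof. by rewrite ffunE (unsplitK (inr j)). Qed.

Lemma lstate_cat (n m : nat) (f : state n) (c : state m) :
  lstate (cat_state f c) = f.
Proof. by apply/ffunP => i; rewrite ffunE cat_state_lshift. Qed.

Lemma rstate_cat (n m : nat) (f : state n) (c : state m) :
  rstate (cat_state f c) = c.
Proof. by apply/ffunP => i; rewrite ffunE cat_state_rshift. Qed.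

Lemma cat_lrstate (n m : nat) (g : state (n + m)) :
  cat_state (lstate g) (rstate g) = g.
Proof.
apply/(@ffunP _ (fun=> bool)) => q; rewrite !ffunE.
by case: splitP => j e; rewrite ffunE; congr (g _); apply: val_inj.
Qed.

Lemma remove_lshift (n m : nat) (p : 'I_n) (g : state (n + m)) :
  remove (lshift m p) g = cat_state (remove p (lstate g)) (rstate g).
Proof.
apply/(@ffunP _ (fun=> bool)) => q; rewrite !ffunE; case: splitP => j e.
  by rewrite !ffunE (_ : q = lshift m j) ?(inj_eq (@lshift_inj _ _)) //; apply: val_inj.
rewrite !ffunE (_ : q = rshift n j); last exact: val_inj.
by rewrite eq_rlshift.
Qed.

Lemma remove_rshift (n m : nat) (p : 'I_m) (g : state (n + m)) :
  remove (rshift n p) g = cat_state (lstate g) (remove p (rstate g)).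
Proof.
apply/(@ffunP _ (fun=> bool)) => q; rewrite !ffunE; case: splitP => j e.
  rewrite !ffunE (_ : q = lshift m j); last exact: val_inj.
  by rewrite eq_lrshift.
by rewrite !ffunE (_ : q = rshift n j) ?(inj_eq (@rshift_inj _ _)) //; apply: val_inj.
Qed.

Lemma weightE (N : nat) (g : state N) : weight g = (\sum_q g q)%N.
Proof. by rewrite /weight -sum1_card big_mkcond. Qed.

Lemma weight_cat (n m : nat) (f : state n) (c : state m) :
  weight (cat_state f c) = (weight f + weight c)%N.
Proof.
rewrite !weightE big_split_ord; congr (_ + _)%N; apply: eq_bigr => i _.
  by rewrite cat_state_lshift.
by rewrite cat_state_rshift.
Qed.

Lemma before_lshift (n m : nat) (p : 'I_n) (f : state n) (c : state m) :
  before (lshift m p) (cat_state f c) = before p f.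
Proof.
rewrite /before big_split_ord /= [X in (_ + X)%N]big1 ?addn0; last first.
  by move=> j /=; have := ltn_ord p; lia.
by apply: eq_bigr => i _; rewrite cat_state_lshift.
Qed.

Lemma before_rshift (n m : nat) (p : 'I_m) (f : state n) (c : state m) :
  before (rshift n p) (cat_state f c) = (weight f + before p c)%N.
Proof.
rewrite /before big_split_ord weightE /=; congr (_ + _)%N.
  by apply: eq_big => [i|i _]; rewrite ?cat_state_lshift //; have := ltn_ord i; lia.
by apply: eq_big => [i|i _]; rewrite ?cat_state_rshift // ltn_add2l.
Qed.

(** With embed c and project c, which insert and read off the state c of the
   closed positions, a partial trace becomes a sum over c (V_tangleE). *)
Definition embed (K : fieldType) (n m : nat) (c : state m) (v : tensor K n) :
    tensor K (n + m) :=
  [ffun g => v (lstate g) *+ (rstate g == c)].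

Definition project (K : fieldType) (n m : nat) (c : state m)
    (w : tensor K (n + m)) : tensor K n :=
  [ffun f => w (cat_state f c)].

Lemma embedE (K : fieldType) (n m : nat) (c : state m) (v : tensor K n)
    (f : state n) (d : state m) :
  embed c v (cat_state f d) = v f *+ (d == c).
Proof. by rewrite ffunE lstate_cat rstate_cat. Qed.

Lemma projectE (K : fieldType) (n m : nat) (c : state m)
    (w : tensor K (n + m)) f : project c w f = w (cat_state f c).
Proof. by rewrite ffunE. Qed.

Lemma embed_sum (K : fieldType) (n m : nat) (c : state m) (v : tensor K n) :
  embed c v = \sum_f v f *: basis_vec K (cat_state f c).
Proof.
apply/ffunP => g; rewrite ffunE sum_ffunE.
rewrite (bigD1 (lstate g)) //= big1 ?addr0 => [|f fg]; rewrite !ffunE /GRing.scale /=.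
  have -> : (g == cat_state (lstate g) c) = (rstate g == c); last by rewrite mulr_natr.
  by apply/eqP/eqP => [{1}->|<-]; rewrite ?rstate_cat ?cat_lrstate.
case: eqP => [e|_]; last by rewrite mulr0.
by rewrite e lstate_cat eqxx in fg.
Qed.

Lemma V_tangleE (K : fieldType) (s : K) (n m : nat) (b : braid_word (n + m))
    (v : tensor K n) :
  V_tangle s b v = \sum_(c : state m) hweight s c *: project c (V_braid s b (embed c v)).
Proof.
apply/ffunP => f'; rewrite endo_ofE sum_ffunE.
under eq_bigr do rewrite mulr_suml.
rewrite exchange_big; apply: eq_bigr => c _; rewrite !ffunE /GRing.scale /=.
rewrite embed_sum linear_sum sum_ffunE mulr_sumr; apply: eq_bigr => f _.
by rewrite linearZ /= ffunE /GRing.scale /=; ring.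
Qed.

Lemma project_is_linear (K : fieldType) (n m : nat) (c : state m) :
  linear (@project K n m c).
Proof. by move=> a u v; apply/ffunP => g; rewrite !ffunE. Qed.

HB.instance Definition _ (K : fieldType) (n m : nat) (c : state m) :=
  GRing.isLinear.Build K (tensor K (n + m)) (tensor K n) _ (@project K n m c)
    (@project_is_linear K n m c).

Lemma embed_is_linear (K : fieldType) (n m : nat) (c : state m) :
  linear (@embed K n m c).
Proof.
move=> a u v; apply/ffunP => g; rewrite !ffunE /GRing.scale /=.
by rewrite mulrnDl mulrnAr.
Qed.

HB.instance Definition _ (K : fieldType) (n m : nat) (c : state m) :=
  GRing.isLinear.Build K (tensor K n) (tensor K (n + m)) _ (@embed K n m c)
    (@embed_is_linear K n m c).

Lemma create_lshift_embed (K : fieldType) (s : K) (n m : nat) (p : 'I_n)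
    (c : state m) (v : tensor K n) :
  create s (lshift m p) (embed c v) = embed c (create s p v).
Proof.
apply/ffunP => g; rewrite -(cat_lrstate g); move: (lstate g) (rstate g) => f d.
rewrite createE embedE createE before_lshift cat_state_lshift remove_lshift.
by rewrite lstate_cat rstate_cat embedE mulrnAr mulrnAC.
Qed.

Lemma project_create_lshift (K : fieldType) (s : K) (n m : nat) (p : 'I_n)
    (c : state m) (w : tensor K (n + m)) :
  project c (create s (lshift m p) w) = create s p (project c w).
Proof.
apply/ffunP => f; rewrite projectE !createE projectE before_lshift cat_state_lshift.
by rewrite remove_lshift lstate_cat rstate_cat.
Qed.

Lemma create_vec_col_mx (K : fieldType) (s : K) (n m : nat) (x : 'cV[K]_n)
    (y : 'cV[K]_m) (w : tensor K (n + m)) :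
  create_vec s (col_mx x y) w =
  \sum_p x p 0 *: create s (lshift m p) w + \sum_j y j 0 *: create s (rshift n j) w.
Proof.
rewrite /create_vec big_split_ord; congr (_ + _); apply: eq_bigr => i _.
  by rewrite col_mxEu.
by rewrite col_mxEd.
Qed.

Definition insert (m : nat) (j : 'I_m) (c : state m) : state m :=
  [ffun q => (q == j) || c q].

Lemma insertE (m : nat) (j : 'I_m) (c : state m) q :
  insert j c q = (q == j) || c q.
Proof. by rewrite ffunE. Qed.

Lemma remove_insert (m : nat) (j : 'I_m) (c : state m) : ~~ c j ->
  remove j (insert j c) = c.
Proof.
move=> /negbTE cj; apply/(@ffunP _ (fun=> bool)) => q; rewrite removeE insertE.
by case: eqP => [->|].
Qed.

Lemma insert_remove (m : nat) (j : 'I_m) (c : state m) : c j ->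
  insert j (remove j c) = c.
Proof.
move=> cj; apply/(@ffunP _ (fun=> bool)) => q; rewrite insertE removeE.
by case: eqP => [->|].
Qed.

Lemma before_insert (m : nat) (j : 'I_m) (c : state m) : ~~ c j ->
  before j (insert j c) = before j c.
Proof. by move=> cj; rewrite -{2}(remove_insert cj) before_remove. Qed.

Lemma weight_insert (m : nat) (j : 'I_m) (c : state m) : ~~ c j ->
  weight (insert j c) = (weight c).+1.
Proof.
move=> /negbTE cj; rewrite !weightE [in LHS](bigD1 j) // [in RHS](bigD1 j) //=.
rewrite insertE eqxx cj add1n add0n; congr (_.+1).
by apply: eq_bigr => q qj; rewrite insertE (negbTE qj).
Qed.

Lemma hweight_insert (K : fieldType) (s : K) (m : nat) (j : 'I_m) (c : state m) :
  ~~ c j -> hweight s (insert j c) = - hweight s c.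
Proof.
move=> /negbTE cj; rewrite /hweight [in LHS](bigD1 j) // [in RHS](bigD1 j) //=.
rewrite insertE eqxx cj expr1 expr0.
rewrite (_ : \prod_(i | i != j) (s * (-1) ^+ insert j c i) =
             \prod_(i | i != j) (s * (-1) ^+ c i)); first by ring.
by apply: eq_bigr => q qj; rewrite insertE (negbTE qj).
Qed.

Definition parity_op (K : fieldType) (N : nat) (v : tensor K N) : tensor K N :=
  weight_op (fun k => (-1) ^+ k) v.

Lemma parity_opE (K : fieldType) (N : nat) (v : tensor K N) g :
  parity_op v g = (-1) ^+ weight g * v g.
Proof. by rewrite ffunE. Qed.

(** The closed positions come last, so the generator created there moves past
   all open positions; this is the origin of the parity operator. *)
Lemma create_rshift_embed (K : fieldType) (s : K) (n m : nat) (j : 'I_m)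
    (c : state m) (v : tensor K n) :
  create s (rshift n j) (embed c v) =
  (s^-1 ^+ (n + j) * (-1) ^+ before j c) *+ ~~ c j *:
    embed (insert j c) (parity_op v).
Proof.
apply/ffunP => g; rewrite -(cat_lrstate g); move: (lstate g) (rstate g) => f d.
rewrite createE tensorZ embedE parity_opE.
rewrite before_rshift cat_state_rshift remove_rshift lstate_cat rstate_cat embedE.
case: (boolP (d j)) => gj; last first.
  rewrite mulr0n; case: eqP => [e|_]; last by rewrite mulr0n mulr0.
  by move: gj; rewrite e insertE eqxx.
rewrite mulr1n; have [e|ne] := eqVneq (remove j d) c; last first.
  case: (boolP (c j)) => cj /=; first by rewrite mulr0n mulr0 mul0r.
  case: eqP => [e|_]; last by rewrite !mulr0n !mulr0.
  by rewrite e remove_insert // eqxx in ne.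
have cj : ~~ c j by rewrite -e removeE eqxx.
rewrite cj -e insert_remove // eqxx !mulr1n before_remove //= [(-1) ^+ (_ + _)]exprD; ring.
Qed.

Lemma project_create_rshift (K : fieldType) (s : K) (n m : nat) (j : 'I_m)
    (c : state m) (w : tensor K (n + m)) :
  project c (create s (rshift n j) w) =
  (s^-1 ^+ (n + j) * (-1) ^+ before j c) *+ c j *:
    parity_op (project (remove j c) w).
Proof.
apply/ffunP => f; rewrite projectE createE tensorZ parity_opE projectE.
rewrite before_rshift cat_state_rshift remove_rshift lstate_cat rstate_cat.
by rewrite [(-1) ^+ (_ + _)]exprD; case: (c j); rewrite ?mulr0n ?mul0r ?mulr1n //=; ring.
Qed.

Lemma parity_embed (K : fieldType) (n m : nat) (c : state m) (v : tensor K n) :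
  embed c (parity_op v) = (-1) ^+ weight c *: parity_op (embed c v).
Proof.
apply/ffunP => g; rewrite -(cat_lrstate g); move: (lstate g) (rstate g) => f d.
rewrite tensorZ embedE !parity_opE embedE weight_cat exprD; case: eqP => [<-|_]; rewrite ?mulr0n ?mulr0 // !mulr1n.
by rewrite mulrA mulrCA -expr2 sqrr_sign mulr1.
Qed.

Lemma parity_project (K : fieldType) (n m : nat) (c : state m) (w : tensor K (n + m)) :
  project c (parity_op w) = (-1) ^+ weight c *: parity_op (project c w).
Proof.
apply/ffunP => g; rewrite tensorZ projectE !parity_opE projectE weight_cat exprD.
by rewrite mulrA [(-1) ^+ weight c * _]mulrC.
Qed.

(** Marking the position j changes the sign of hweight. This sign cancels the
   one that arises when the created generator moves past the open positions
   from the bottom to the top of the braid, which preserves parity. *)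
Lemma supertrace_cyclic (K : fieldType) (s : K) (s0 : s != 0) (n m : nat)
    (b : braid_word (n + m)) (j : 'I_m) (v : tensor K n) :
  \sum_c hweight s c *:
     project c (V_braid s b (create s (rshift n j) (embed c v))) =
  \sum_c hweight s c *:
     project c (create s (rshift n j) (V_braid s b (embed c v))).
Proof.
under eq_bigr do rewrite create_rshift_embed linearZ linearZ.
under [RHS]eq_bigr do rewrite project_create_rshift.
rewrite (bigID (fun c : state m => c j)) big1 ?add0r /=; last first.
  by move=> c ->; rewrite /= mulr0n scale0r scaler0.
rewrite [RHS](bigID (fun c : state m => ~~ c j)) /= [X in _ = X + _]big1 ?add0r; last first.
  by move=> c /negbTE ->; rewrite mulr0n scale0r scaler0.
rewrite [RHS](reindex_onto (insert j) (remove j)) /=; last first.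
  by move=> c /negbNE cj; rewrite insert_remove.
apply: eq_big => [c|c cj].
  rewrite insertE eqxx /=; apply/idP/eqP => [|<-]; first exact: remove_insert.
  by rewrite removeE eqxx.
rewrite cj insertE eqxx before_insert // hweight_insert // remove_insert //.
rewrite !mulr1n !scalerA parity_embed linearZ /= braid_weight_op // linearZ /=.
rewrite parity_project scalerA weight_insert // exprS.
rewrite scalerA; congr (_ *: _).
by rewrite mulN1r mulrN mulNr -mulrA -expr2 sqrr_sign mulr1 mulNr.
Qed.

(** The middle factor stands for the sum of the powers of the block from
   closed to closed positions, i.e. for any number of turns. *)
Definition closure_mx (F : fieldType) (n m : nat) (M : 'M[F]_(n + m)) : 'M[F]_n :=
  ulsubmx M + ursubmx M *m invmx (1%:M - drsubmx M) *m dlsubmx M.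

(** With the vector y of the proof, M maps x + y to closure_mx M x + y. The
   contributions of y at the bottom and at the top agree by supertrace_cyclic
   and cancel in braid_create_vec. *)
Theorem tangle_create_vec (K : fieldType) (s : K) (s0 : s != 0) (n m : nat)
    (b : braid_word (n + m)) (x : 'cV[K]_n) (v : tensor K n) :
  let M := burau (s ^+ 2) b in
  1%:M - drsubmx M \in unitmx ->
  V_tangle s b (create_vec s x v) =
  create_vec s (closure_mx M *m x) (V_tangle s b v).
Proof.
move=> M unitD; pose y := invmx (1%:M - drsubmx M) *m dlsubmx M *m x.
have My : M *m col_mx x y = col_mx (closure_mx M *m x) y.
  rewrite -{1}(submxK M) mul_block_col; congr col_mx.
    by rewrite /closure_mx mulmxDl /y !mulmxA.
  have <- : (1%:M - drsubmx M) *m y = dlsubmx M *m x by rewrite /y -mulmxA mulKVmx.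
  by rewrite mulmxBl mul1mx subrK.
have emb c : create_vec s (col_mx x y) (embed c v) =
    embed c (create_vec s x v) + \sum_j y j 0 *: create s (rshift n j) (embed c v).
  rewrite create_vec_col_mx linear_sum; congr (_ + _).
  by apply: eq_bigr => p _; rewrite create_lshift_embed linearZ.
have prj c (w : tensor K (n + m)) : project c (create_vec s (col_mx (closure_mx M *m x) y) w) =
    create_vec s (closure_mx M *m x) (project c w)
    + \sum_j y j 0 *: project c (create s (rshift n j) w).
  rewrite create_vec_col_mx linearD !linear_sum; congr (_ + _).
    by apply: eq_bigr => p _; rewrite linearZ /= project_create_lshift.
  by apply: eq_bigr => p _; rewrite linearZ.
pose T u := \sum_c hweight s c *: project c (V_braid s b (u c)).
have EL : T (fun c => create_vec s (col_mx x y) (embed c v)) =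
    V_tangle s b (create_vec s x v)
    + \sum_j y j 0 *: T (fun c => create s (rshift n j) (embed c v)).
  under [in RHS]eq_bigr do rewrite /T scaler_sumr.
  rewrite V_tangleE [X in _ = _ + X]exchange_big -big_split; apply: eq_bigr => c _ /=.
  rewrite emb 3!linearD /=; congr (_ + _); rewrite 3!linear_sum /=.
  by apply: eq_bigr => j _; rewrite !linearZ /= !scalerA mulrC.
have ER : T (fun c => create_vec s (col_mx x y) (embed c v)) =
    create_vec s (closure_mx M *m x) (V_tangle s b v)
    + \sum_j y j 0 *: T (fun c => create s (rshift n j) (embed c v)).
  under [in RHS]eq_bigr do rewrite /T supertrace_cyclic // scaler_sumr.
  rewrite V_tangleE linear_sum [X in _ = _ + X]exchange_big -big_split; apply: eq_bigr => c _ /=.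
  rewrite braid_create_vec // My prj scalerDr; congr (_ + _); first by rewrite linearZ.
  rewrite scaler_sumr.
  by apply: eq_bigr => j _; rewrite !scalerA mulrC.
by move: EL; rewrite ER => /addIr.
Qed.

(** * Exterior products as states *)

Definition vacuum (K : fieldType) (N : nat) : tensor K N :=
  basis_vec K [ffun=> false].

Lemma weight_eq0 (N : nat) (g : state N) : (weight g == 0%N) = (g == [ffun=> false]).
Proof.
rewrite weightE sum_nat_eq0; apply/forallP/eqP => [H|-> i]; last by rewrite ffunE.
by apply/ffunP => i; rewrite ffunE; move: (H i); case: (g i).
Qed.

Lemma weight_op_id (K : fieldType) (N k : nat) (v : tensor K N) :
  (forall g, weight g != k -> v g = 0) ->
  weight_op (fun l => (l == k)%:R) v = v.
Proof.
move=> vk; apply/ffunP => g; rewrite ffunE.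
by have [_|/vk ->] := eqVneq (weight g) k; rewrite ?mul1r ?mulr0.
Qed.

(** The vacuum spans the part of weight 0, which the closed braid preserves. *)
Lemma tangle_vacuum (K : fieldType) (s : K) (s0 : s != 0) (n m : nat)
    (b : braid_word (n + m)) :
  V_tangle s b (vacuum K n) = W0 s b *: vacuum K n.
Proof.
apply/ffunP => g; rewrite tensorZ.
have [->|g0] := eqVneq g [ffun=> false]; first by rewrite /vacuum ffunE eqxx mulr1.
rewrite [vacuum _ _ _]ffunE (negbTE g0) mulr0 V_tangleE sum_ffunE big1 // => c _.
rewrite tensorZ projectE -(@weight_op_id _ _ (weight c) (embed c (vacuum K n))).
  rewrite braid_weight_op // ffunE weight_cat -{2}[weight c]add0n eqn_add2r.
  by rewrite weight_eq0 (negbTE g0) mul0r mulr0.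
move=> h; move: (lstate h) (rstate h) (cat_lrstate h) => f d <-.
rewrite weight_cat embedE [vacuum _ _ _]ffunE.
have [->|_] := eqVneq d c; last by rewrite mulr0n.
by rewrite -[X in _ != X]add0n eqn_add2r weight_eq0 => /negbTE ->; rewrite mul0rn.
Qed.

Definition creates (K : fieldType) (s : K) (N : nat) (xs : seq 'cV[K]_N) :
    tensor K N :=
  foldr (create_vec s (N:=N)) (vacuum K N) xs.

Lemma tangle_creates (K : fieldType) (s : K) (s0 : s != 0) (n m : nat)
    (b : braid_word (n + m)) (xs : seq 'cV[K]_n) :
  let M := burau (s ^+ 2) b in
  1%:M - drsubmx M \in unitmx ->
  V_tangle s b (creates s xs) =
  W0 s b *: creates s [seq closure_mx M *m x | x <- xs].
Proof.
move=> M uD; elim: xs => [|x xs IH] /=; first exact: tangle_vacuum.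
by rewrite tangle_create_vec // IH linearZ.
Qed.

Lemma creates_weight (K : fieldType) (s : K) (N : nat) (xs : seq 'cV[K]_N) g :
  weight g != size xs -> creates s xs g = 0.
Proof.
elim: xs g => [|x xs IH] g /=.
  by rewrite weight_eq0 => /negbTE g0; rewrite ffunE g0.
move=> wg; rewrite create_vecE big1 // => p _; rewrite createE.
case: (boolP (g p)) => gp; last by rewrite mulr0n mulr0.
rewrite IH ?mulr0 ?mul0rn ?mulr0 //; apply: contra wg => /eqP <-.
by rewrite -{1}(insert_remove gp) weight_insert // removeE eqxx.
Qed.

Definition state_of (k n : nat) (f : 'I_k -> 'I_n) : state n :=
  [ffun q => q \in codom f].

Definition ord_increasing (k n : nat) (f : 'I_k -> 'I_n) : Prop :=
  forall a b : 'I_k, (a < b)%N -> (f a < f b)%N.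

Lemma ord_increasing_mono (k n : nat) (f : 'I_k -> 'I_n) : ord_increasing f ->
  forall a b : 'I_k, (f a < f b)%N = (a < b)%N.
Proof.
move=> fi a b; apply/idP/idP => [fab|]; last exact: fi.
rewrite ltnNge; apply/negP; rewrite leq_eqVlt => /orP[/eqP/val_inj e|/fi].
  by move: fab; rewrite e ltnn.
by move/ltn_trans => /(_ _ fab); rewrite ltnn.
Qed.

Lemma ord_increasing_inj (k n : nat) (f : 'I_k -> 'I_n) : ord_increasing f -> injective f.
Proof.
move=> fi a b fab; apply/val_inj.
by case: (ltngtP (val a) (val b)) => // /fi; rewrite fab ltnn.
Qed.

Lemma ord_increasing_lift (k n : nat) (f : 'I_k.+1 -> 'I_n) a : ord_increasing f ->
  ord_increasing (f \o lift a).
Proof.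
by move=> fi b c bc; apply: fi; rewrite /= ltnNge leq_bump2 -ltnNge.
Qed.

Lemma before_state_of (k n : nat) (f : 'I_k -> 'I_n) a : ord_increasing f ->
  before (f a) (state_of f) = a.
Proof.
move=> fi; rewrite /before.
transitivity (\sum_(q in codom f) (q < f a)%N : nat)%N.
  rewrite big_mkcond [RHS]big_mkcond; apply: eq_bigr => q _; rewrite ffunE.
  by case: (q \in _); case: ltnP.
rewrite (eq_bigl (fun q => q \in f @: 'I_k)); last first.
  by move=> q; apply/codomP/imsetP => [[b ->]|[b _ ->]]; exists b.
rewrite big_imset /=; last by move=> ? ? _ _; apply: ord_increasing_inj.
rewrite (eq_bigr (fun b : 'I_k => nat_of_bool (b < a)%N)); last first.
  by move=> b _; rewrite ord_increasing_mono.
rewrite -(big_mkcond (fun b : 'I_k => (b < a)%N) (fun=> 1%N)) /=.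
by rewrite -(big_ord_widen k (fun=> 1%N)) 1?ltnW // sum1_card card_ord.
Qed.

Lemma remove_state_of (k n : nat) (f : 'I_k.+1 -> 'I_n) a : injective f ->
  remove (f a) (state_of f) = state_of (f \o lift a).
Proof.
move=> fi; apply/(@ffunP _ (fun=> bool)) => q; rewrite removeE !ffunE.
apply/andP/codomP => [[qa /codomP[b e]]|[b ->]]; last first.
  by split; [rewrite (inj_eq fi) eq_sym neq_lift | exact: codom_f].
have ab : a != b by apply: contra qa => /eqP ->; rewrite e.
by case/unlift_some: ab => c bc _; exists c; rewrite e bc.
Qed.

Lemma weight_state_of (k n : nat) (f : 'I_k -> 'I_n) : injective f ->
  weight (state_of f) = k.
Proof.
move=> fi; rewrite -[RHS](card_ord k) -(card_codom fi) /weight.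
by apply: eq_card => q; rewrite !inE ffunE.
Qed.

(** The coordinates of a wedge are minors: applying one more creation operator
   is the Laplace expansion along the first column, as the sign in create
   counts the rows above the deleted one. *)
Lemma creates_state_of (K : fieldType) (s : K) (k n : nat)
    (x : 'I_k -> 'cV[K]_n) (f : 'I_k -> 'I_n) : ord_increasing f ->
  creates s [seq x a | a <- enum 'I_k] (state_of f) =
  \prod_a s^-1 ^+ f a * \det (\matrix_(a, b) x b (f a) 0).
Proof.
elim: k x f => [|k IH] x f fi.
  rewrite (_ : enum 'I_0 = [::]); last by apply: size0nil; rewrite size_enum_ord.
  rewrite /= det_mx00 big_ord0 mulr1 ffunE -weight_eq0 weight_state_of //.
  exact: ord_increasing_inj.
rewrite enum_ordSl /= create_vecE -map_comp.
rewrite (bigID (fun q => q \in f @: 'I_k.+1)) /= [X in _ + X]big1 ?addr0; last first.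
  move=> q qf; rewrite createE ffunE; case: (boolP (q \in codom f)) => [/codomP[a e]|_].
    by rewrite e imset_f in qf.
  by rewrite mulr0n mulr0.
have finj := ord_increasing_inj fi.
rewrite big_imset /=; last by move=> ? ? _ _; exact: finj.
rewrite (expand_det_col _ ord0) mulr_sumr; apply: eq_bigr => a _.
rewrite createE before_state_of // remove_state_of // ffunE codom_f mulr1n.
rewrite (IH _ _ (@ord_increasing_lift _ _ f a fi)) (bigD1_ord a) //= /cofactor mxE addn0.
rewrite (_ : row' a (col' ord0 _) =
             \matrix_(a', b') x (lift ord0 b') (f (lift a a')) 0); last first.
  by apply/matrixP => a' b'; rewrite !mxE.
by rewrite /=; ring.
Qed.

Lemma ord_increasing_sorted (k n : nat) (f : 'I_k -> 'I_n) : ord_increasing f ->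
  sorted (fun p q : 'I_n => p < q)%N (codom f).
Proof.
move=> fi; rewrite codomE sorted_map.
apply: (sub_sorted (e := fun a b : 'I_k => (a < b)%N)) => [a b|]; first exact: fi.
by have := iota_ltn_sorted 0 k; rewrite -val_enum_ord sorted_map.
Qed.

Lemma state_of_inj (k n : nat) :
  injective (fun f : inc_fun k n => state_of (val f)).
Proof.
move=> [f fi] [g gi] /= /ffunP E; apply: val_inj => /=.
have e : codom f = codom g.
  apply: (@irr_sorted_eq _ (fun p q : 'I_n => p < q)%N).
  - by move=> ? ? ?; exact: ltn_trans.
  - by move=> ?; exact: ltnn.
  - by apply: ord_increasing_sorted => a b; exact/increasingP.
  - by apply: ord_increasing_sorted => a b; exact/increasingP.
  - by move=> q; move: (E q); rewrite !ffunE.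
apply/ffunP => a; move: e; rewrite !codomE => /eq_in_map; apply.
by rewrite mem_enum.
Qed.

Lemma state_of_surj (k n : nat) (g : state n) : weight g = k ->
  exists f : inc_fun k n, state_of (val f) = g.
Proof.
move=> wg; pose A := [pred i | g i].
have wA : k = #|A| by rewrite -wg.
pose h : {ffun 'I_k -> 'I_n} := [ffun a => enum_val (cast_ord wA a)].
have hi : injective h.
  by move=> a b; rewrite !ffunE => /enum_val_inj /cast_ord_inj.
have [[f r] /= hf] := inc_fun_perm_surj hi; exists f.
apply/ffunP => q; rewrite ffunE; apply/codomP/idP => [[a ->]|gq].
  rewrite -[a](permKV r); have := enum_valP (cast_ord wA ((r^-1)%g a)).
  by have := congr1 (fun u : {ffun _ -> _} => u ((r^-1)%g a)) hf; rewrite !ffunE => ->.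
have qA : q \in A by [].
exists (r (cast_ord (esym wA) (enum_rank_in qA q))).
have := congr1 (fun u : {ffun _ -> _} => u (cast_ord (esym wA) (enum_rank_in qA q))) hf.
by rewrite !ffunE cast_ordKV enum_rankK_in.
Qed.

Lemma create_basis (K : fieldType) (s : K) (N : nat) (p : 'I_N) (g : state N) :
  ~~ g p -> create s p (basis_vec K g) =
    (s^-1 ^+ p * (-1) ^+ before p g) *: basis_vec K (insert p g).
Proof.
move=> gp; apply/ffunP => h; rewrite createE tensorZ /basis_vec !ffunE.
have [->|hg] := eqVneq h (insert p g).
  by rewrite remove_insert // eqxx before_insert // insertE eqxx.
rewrite mulr0; case: (boolP (h p)) => hp; rewrite ?mulr0n // mulr1n.
case: eqP => [e|_]; last by rewrite mulr0.
by rewrite -e insert_remove // eqxx in hg.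
Qed.

Lemma creates_basis (K : fieldType) (s : K) (k n : nat) (f : 'I_k -> 'I_n) :
  ord_increasing f ->
  creates s [seq delta_mx (f a) 0 | a <- enum 'I_k] =
  (\prod_a s^-1 ^+ f a) *: basis_vec K (state_of f).
Proof.
elim: k f => [|k IH] f fi.
  rewrite (_ : enum 'I_0 = [::]); last by apply: size0nil; rewrite size_enum_ord.
  rewrite /= big_ord0 scale1r; congr basis_vec; apply/eqP.
  by rewrite eq_sym -weight_eq0 weight_state_of //; exact: ord_increasing_inj.
rewrite enum_ordSl /= create_col -map_comp.
rewrite (IH _ (@ord_increasing_lift _ _ f ord0 fi)) linearZ /=.
have finj := ord_increasing_inj fi.
rewrite -remove_state_of // create_basis ?removeE ?eqxx // before_remove //.
rewrite before_state_of // mulr1 insert_remove ?ffunE ?codom_f //.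
by rewrite scalerA big_ord_recl mulrC.
Qed.

Lemma mem_Wspace (K : fieldType) (n k : nat) (v : tensor K n) :
  reflect (forall g, weight g != k -> v g = 0) (v \in Wspace K n k).
Proof.
apply: (iffP idP) => [|H].
  rewrite /Wspace; set X := [seq _ | _ <- _ & _] => vX g gk.
  rewrite (coord_span (X := in_tuple X) vX) sum_ffunE big1 // => i _.
  rewrite tensorZ; have : (in_tuple X)`_i \in X by rewrite mem_nth.
  move/mapP => [f]; rewrite mem_filter => /andP[/eqP fk _] ->.
  rewrite ffunE; case: eqP => [e|_]; last by rewrite mulr0.
  by move: gk; rewrite e /weight fk eqxx.
have -> : v = \sum_f v f *: basis_vec K f.
  apply/ffunP => g; rewrite sum_ffunE (bigD1 g) //= big1 ?addr0.
    by rewrite tensorZ ffunE eqxx mulr1.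
  by move=> f fg; rewrite tensorZ ffunE eq_sym (negbTE fg) mulr0.
apply: memv_suml => f _; have [fk|/H ->] := eqVneq (weight f) k; last first.
  by rewrite scale0r mem0v.
apply/memvZ/memv_span/map_f; rewrite mem_filter mem_enum andbT.
exact/eqP.
Qed.

(** The powers of s undo the rescaling in create, so that products of creation
   operators go to wedges of the same vectors (Wcoord_creates). *)
Definition Wcoord (K : fieldType) (s : K) (n k : nat)
    (w : subvs_of (Wspace K n k)) : extpow K k n :=
  [ffun f : inc_fun k n => (\prod_a s ^+ val f a) * vsval w (state_of (val f))].

Lemma WcoordE (K : fieldType) (s : K) (n k : nat)
    (w : subvs_of (Wspace K n k)) f :
  Wcoord s w f = (\prod_a s ^+ val f a) * vsval w (state_of (val f)).
Proof. by rewrite ffunE. Qed.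

Lemma Wcoord_is_linear (K : fieldType) (s : K) (n k : nat) :
  linear (@Wcoord K s n k).
Proof.
move=> a u v; apply/ffunP => f.
rewrite WcoordE [RHS]ffunE [X in _ = X + _]ffunE !WcoordE linearP tensorD tensorZ.
by rewrite /GRing.scale /=; ring.
Qed.

HB.instance Definition _ (K : fieldType) (s : K) (n k : nat) :=
  GRing.isLinear.Build K (subvs_of (Wspace K n k)) (extpow K k n) _
    (@Wcoord K s n k) (@Wcoord_is_linear K s n k).

Lemma inc_fun_homo (k n : nat) (f : inc_fun k n) : ord_increasing (val f).
Proof. by move=> a b; apply: increasingP; exact: valP. Qed.

(** This presents an arbitrary w by wedges of unit vectors, the form in which
   the action of the closed braid is known. *)
Lemma vsval_Wcoord (K : fieldType) (s : K) (s0 : s != 0) (n k : nat)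
    (w : subvs_of (Wspace K n k)) :
  vsval w = \sum_f Wcoord s w f *: creates s [seq delta_mx (val f a) 0 | a <- enum 'I_k].
Proof.
have /mem_Wspace wk := subvsP w.
apply/ffunP => g; rewrite sum_ffunE.
have prod1 (f : 'I_k -> 'I_n) :
    (\prod_a s ^+ f a) * (\prod_a s^-1 ^+ f a) = 1.
  by rewrite -big_split big1 // => a _; rewrite /= -exprMn mulfV // expr1n.
have E (f : inc_fun k n) :
    (Wcoord s w f *: creates s [seq delta_mx (val f a) 0 | a <- enum 'I_k]) g
    = vsval w (state_of (val f)) * (g == state_of (val f))%:R.
  rewrite creates_basis; last exact: inc_fun_homo.
  rewrite scalerA tensorZ WcoordE [basis_vec _ _ _]ffunE; congr (_ * _).
  by rewrite mulrAC prod1 mul1r.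
under eq_bigr do rewrite E.
have [gk|gk] := eqVneq (weight g) k.
  have [f <-] := state_of_surj gk.
  rewrite (bigD1 f) //= eqxx mulr1 big1 ?addr0 // => h hf.
  by rewrite [_ == _]eq_sym (inj_eq (@state_of_inj _ _)) (negbTE hf) mulr0.
rewrite wk // big1 // => f _; case: eqP => [e|_]; last by rewrite mulr0.
by move: gk; rewrite e weight_state_of ?eqxx //; apply/ord_increasing_inj/inc_fun_homo.
Qed.

Lemma Wcoord_creates (K : fieldType) (s : K) (s0 : s != 0) (n k : nat)
    (x : 'I_k -> 'cV[K]_n) (w : subvs_of (Wspace K n k)) :
  vsval w = creates s [seq x a | a <- enum 'I_k] -> Wcoord s w = wedge x.
Proof.
move=> e; apply/ffunP => f; rewrite WcoordE [RHS]ffunE e creates_state_of; last exact: inc_fun_homo.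
by rewrite mulrA -big_split big1 ?mul1r // => a _; rewrite /= -exprMn mulfV // expr1n.
Qed.

Lemma Wcoord_bij (K : fieldType) (s : K) (s0 : s != 0) (n k : nat) :
  bijective (@Wcoord K s n k).
Proof.
pose G (v : extpow K k n) : subvs_of (Wspace K n k) :=
  vsproj (Wspace K n k) (\sum_f v f *: creates s [seq delta_mx (val f a) 0 | a <- enum 'I_k] : tensor K n).
have GK v : vsval (G v) = \sum_f v f *: creates s [seq delta_mx (val f a) 0 | a <- enum 'I_k].
  apply: vsprojK; apply/mem_Wspace => g gk.
  rewrite sum_ffunE big1 // => f _; rewrite tensorZ creates_weight ?mulr0 //.
  by rewrite size_map size_enum_ord.
exists G => [w|v]; first by apply: val_inj; rewrite /= GK -vsval_Wcoord.
apply/ffunP => g; rewrite WcoordE GK sum_ffunE mulr_sumr (bigD1 g) //=.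
rewrite tensorZ creates_basis; last exact: inc_fun_homo.
rewrite tensorZ /basis_vec ffunE eqxx mulr1 mulrCA -big_split big1 ?mulr1; last first.
  by move=> a _; rewrite /= -exprMn mulfV // expr1n.
rewrite big1 ?addr0 // => f fg; rewrite tensorZ creates_basis; last exact: inc_fun_homo.
rewrite tensorZ ffunE (inj_eq (@state_of_inj _ _)) eq_sym (negbTE fg) !mulr0 //.
Qed.

Theorem Wcoord_W_over0 (K : fieldType) (s : K) (s0 : s != 0) (n k m : nat)
    (b : braid_word (n + m)) (w : subvs_of (Wspace K n k)) :
  let M := burau (s ^+ 2) b in
  1%:M - drsubmx M \in unitmx -> W0 s b != 0 ->
  Wcoord s (W_over0 s b w) = extpow_map (closure_mx M) (Wcoord s w).
Proof.
move=> M uD W0n; pose A := closure_mx M.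
pose c (f : inc_fun k n) := creates s [seq col (val f a) A | a <- enum 'I_k].
have Tw : V_tangle s b (vsval w) = W0 s b *: \sum_(f : inc_fun k n) Wcoord s w f *: c f.
  rewrite {1}(vsval_Wcoord s0 w) linear_sum scaler_sumr; apply: eq_bigr => f _.
  rewrite linearZ /= tangle_creates // scalerA mulrC -scalerA; congr (_ *: (_ *: _)).
  by rewrite -map_comp; congr creates; apply: eq_map => a /=; rewrite colE.
have ck f : c f \in Wspace K n k.
  by apply/mem_Wspace => g gk; rewrite creates_weight // size_map size_enum_ord.
rewrite /W_over0 /W_map Tw 3!linearZ /= scalerA mulVf // scale1r linear_sum linear_sum.
rewrite /extpow_map; apply: eq_bigr => f _ /=; rewrite linearZ linearZ /=; congr (_ *: _).
by apply: Wcoord_creates => //; rewrite vsprojK.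
Qed.

(** * Specialization of rational functions *)

Local Notation "p %:F" := (@FracField.tofrac _ p).

Section Specialization.
Variables (F : fieldType) (phi : {rmorphism {poly rat} -> F}).

(** The fraction x is regular at the point defined by phi and has the value y
   there. This is a relation because evaluation is defined only on a subring
   of the field of fractions. *)
Definition specializes (x : ratfrac) (y : F) : Prop :=
  exists p q : {poly rat},
    [/\ phi q != 0, x = p%:F / q%:F & y = phi p / phi q].

Lemma denom_neq0 (q : {poly rat}) : phi q != 0 -> q%:F != 0 :> ratfrac.
Proof. by rewrite tofrac_eq0; apply: contra => /eqP ->; rewrite rmorph0. Qed.

Lemma specializes_poly p : specializes p%:F (phi p).
Proof. by exists p, 1; rewrite !rmorph1 !divr1 oner_neq0. Qed.

Lemma specializes0 : specializes 0 0.
Proof. by have := specializes_poly 0; rewrite !rmorph0. Qed.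

Lemma specializes1 : specializes 1 1.
Proof. by have := specializes_poly 1; rewrite !rmorph1. Qed.

Lemma specializesD x y x' y' :
  specializes x y -> specializes x' y' -> specializes (x + x') (y + y').
Proof.
move=> [p [q [q0 -> ->]]] [p' [q' [q0' -> ->]]].
exists (p * q' + p' * q), (q * q'); rewrite !(rmorphD, rmorphM) mulf_neq0 //.
by rewrite !addf_div // denom_neq0.
Qed.

Lemma specializesM x y x' y' :
  specializes x y -> specializes x' y' -> specializes (x * x') (y * y').
Proof.
move=> [p [q [q0 -> ->]]] [p' [q' [q0' -> ->]]].
exists (p * p'), (q * q'); rewrite !rmorphM mulf_neq0 //.
by rewrite !mulf_div.
Qed.

Lemma specializesN x y : specializes x y -> specializes (- x) (- y).
Proof.
move=> [p [q [q0 -> ->]]]; exists (- p), q.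
by rewrite !rmorphN !mulNr.
Qed.

Lemma specializesB x y x' y' :
  specializes x y -> specializes x' y' -> specializes (x - x') (y - y').
Proof. by move=> H /specializesN; exact: specializesD. Qed.

Lemma specializesV x y : y != 0 -> specializes x y -> specializes x^-1 y^-1.
Proof.
move=> y0 [p [q [q0 ex ey]]]; exists q, p; rewrite ex ey !invf_div; split=> //.
by move: y0; rewrite ey mulf_eq0 negb_or => /andP[].
Qed.

Lemma specializesX x y k : specializes x y -> specializes (x ^+ k) (y ^+ k).
Proof.
move=> H; elim: k => [|k IH]; first by rewrite !expr0; exact: specializes1.
by rewrite !exprS; exact: specializesM.
Qed.

Lemma specializes_bool x y (e : bool) :
  specializes x y -> specializes (x *+ e) (y *+ e).
Proof. by case: e => // _; exact: specializes0. Qed.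

Lemma specializes_sum (I : Type) (r : seq I) (P : pred I) f g :
  (forall i, P i -> specializes (f i) (g i)) ->
  specializes (\sum_(i <- r | P i) f i) (\sum_(i <- r | P i) g i).
Proof.
move=> H; elim/big_ind2: _ => //; first exact: specializes0.
by move=> ? ? ? ?; exact: specializesD.
Qed.

Lemma specializes_prod (I : Type) (r : seq I) (P : pred I) f g :
  (forall i, P i -> specializes (f i) (g i)) ->
  specializes (\prod_(i <- r | P i) f i) (\prod_(i <- r | P i) g i).
Proof.
move=> H; elim/big_ind2: _ => //; first exact: specializes1.
by move=> ? ? ? ?; exact: specializesM.
Qed.

Lemma specializes_frac (p q p' q' : {poly rat}) : phi q != 0 -> phi q' != 0 ->
  p%:F / q%:F = p'%:F / q'%:F :> ratfrac -> phi p / phi q = phi p' / phi q'.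
Proof.
move=> q0 q0' /eqP; rewrite eqr_div ?denom_neq0 // -!rmorphM tofrac_eq => /eqP e.
by apply/eqP; rewrite eqr_div // -!rmorphM e.
Qed.

Lemma specializes_unique x y y' : specializes x y -> specializes x y' -> y = y'.
Proof.
move=> [p [q [q0 -> ->]]] [p' [q' [q0' + ->]]]; exact: specializes_frac.
Qed.

(** Nonvanishing of a rational function is checked at a single point. *)
Lemma specializes_neq0 x y : specializes x y -> y != 0 -> x != 0.
Proof.
move=> H; apply: contra => /eqP e; apply/eqP; move: H; rewrite e => H.
exact: specializes_unique H specializes0.
Qed.

Definition specializes_mx (m n : nat) (A : 'M[ratfrac]_(m, n)) (B : 'M[F]_(m, n)) :=
  forall i j, specializes (A i j) (B i j).

Lemma specializes_mulmx (m n r : nat) (A : 'M[ratfrac]_(m, n)) B (C : 'M[ratfrac]_(n, r)) D :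
  specializes_mx A B -> specializes_mx C D -> specializes_mx (A *m C) (B *m D).
Proof.
move=> AB CD i j; rewrite !mxE; apply: specializes_sum => l _.
exact: specializesM.
Qed.

Lemma specializes_scalar_mx1 (n : nat) : specializes_mx (1%:M : 'M[ratfrac]_n) 1%:M.
Proof. by move=> i j; rewrite !mxE; apply: specializes_bool; exact: specializes1. Qed.

Lemma specializes_addmx (m n : nat) (A : 'M[ratfrac]_(m, n)) B C D :
  specializes_mx A B -> specializes_mx C D -> specializes_mx (A + C) (B + D).
Proof. by move=> AB CD i j; rewrite !mxE; exact: specializesD. Qed.

Lemma specializes_oppmx (m n : nat) (A : 'M[ratfrac]_(m, n)) B :
  specializes_mx A B -> specializes_mx (- A) (- B).
Proof. by move=> AB i j; rewrite !mxE; exact: specializesN. Qed.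

Lemma specializes_sign k : specializes ((-1) ^+ k) ((-1) ^+ k).
Proof. exact/specializesX/specializesN/specializes1. Qed.

Lemma specializes_det (n : nat) (A : 'M[ratfrac]_n) B :
  specializes_mx A B -> specializes (\det A) (\det B).
Proof.
move=> AB; apply: specializes_sum => u _; apply: specializesM.
  exact: specializes_sign.
by apply: specializes_prod => i _.
Qed.

Lemma specializes_invmx (n : nat) (A : 'M[ratfrac]_n) B : \det B != 0 ->
  specializes_mx A B -> specializes_mx (invmx A) (invmx B).
Proof.
move=> B0 AB i j; have dA := specializes_det AB.
rewrite /invmx !unitmxE !unitfE B0 (specializes_neq0 dA B0) !mxE.
apply: specializesM; first exact: specializesV.
apply: specializesM; first exact: specializes_sign.
by apply: specializes_det => k l; rewrite !mxE.
Qed.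

Lemma specializes_closure (n m : nat) (A : 'M[ratfrac]_(n + m)) B :
  \det (1%:M - drsubmx B) != 0 ->
  specializes_mx A B -> specializes_mx (closure_mx A) (closure_mx B).
Proof.
move=> B0 AB; have sub i j : specializes (A i j) (B i j) by [].
apply: specializes_addmx; first by move=> i j; rewrite !mxE.
apply: specializes_mulmx; last by move=> i j; rewrite !mxE.
apply: specializes_mulmx; first by move=> i j; rewrite !mxE.
apply: specializes_invmx => //; apply: specializes_addmx.
  exact: specializes_scalar_mx1.
by apply: specializes_oppmx => i j; rewrite !mxE.
Qed.

Lemma specializes_letter_mx (t : ratfrac) (u : F) (N : nat) (x : letter N) :
  u != 0 -> specializes t u -> specializes_mx (letter_mx t x) (letter_mx u x).
Proof.
move=> u0 tu q p; rewrite !mxE; apply: specializes_bool.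
rewrite /letter_weight; case: ifP => _; last exact: specializes1.
have {}tu : specializes (if x.2 then t else t^-1) (if x.2 then u else u^-1).
  by case: (x.2) => //; exact: specializesV.
by case: ifP => _ //; exact: specializesB specializes1 tu.
Qed.

Lemma specializes_burau (t : ratfrac) (u : F) (N : nat) (b : braid_word N) :
  u != 0 -> specializes t u -> specializes_mx (burau t b) (burau u b).
Proof.
move=> u0 tu; elim/last_ind: b => [|b x IH]; first exact: specializes_scalar_mx1.
rewrite !burau_rcons; apply: specializes_mulmx => //.
exact: specializes_letter_mx.
Qed.

Definition specializes_tensor (N : nat) (v : tensor ratfrac N) (w : tensor F N) :=
  forall g, specializes (v g) (w g).

Lemma specializes_gen (s : ratfrac) (u : F) (N : nat) (i : 'I_N.-1) v w :
  u != 0 -> specializes s u -> specializes_tensor v w ->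
  specializes_tensor (V_gen s i v) (V_gen u i w).
Proof.
move=> u0 su vw g; rewrite !V_genE.
have sV := specializesV u0 su; have sN := specializesN su.
have sB := specializesB sV su.
case: ifP => _; first by apply: specializesM => //; case: ifP.
apply: specializesD => //; case: ifP => _; last exact: specializes0.
exact: specializesM.
Qed.

Lemma specializes_braid (s : ratfrac) (u : F) (N : nat) (b : braid_word N) v w :
  u != 0 -> specializes s u -> specializes_tensor v w ->
  specializes_tensor (V_braid s b v) (V_braid u b w).
Proof.
move=> u0 su vw; elim/last_ind: b => [|b [i e] IH]; first by rewrite !V_braid_nil.
have s0 := specializes_neq0 su u0.
have Hg := @specializes_gen s u N i _ _ u0 su IH.
rewrite !V_braid_rcons /V_letter; case: e => //=; rewrite !V_gen_inv // => g.
rewrite !ffunE /GRing.scale /=; apply: specializesB; first exact: Hg.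
apply: specializesM; last exact: IH.
exact: specializesB (specializesV u0 su) su.
Qed.

Lemma specializes_W0 (s : ratfrac) (u : F) (n m : nat) (b : braid_word (n + m)) :
  u != 0 -> specializes s u -> specializes (W0 s b) (W0 u b).
Proof.
move=> u0 su; rewrite /W0 !V_tangleE !sum_ffunE; apply: specializes_sum => c _.
rewrite !tensorZ !projectE; apply: specializesM.
  apply: specializes_prod => j _; apply: specializesM => //.
  exact: specializes_sign.
apply: specializes_braid => // g; rewrite !ffunE.
by do 2! apply: specializes_bool; exact: specializes1.
Qed.

End Specialization.

Lemma follow_rcons (N : nat) (b : braid_word N) y p :
  follow (rcons b y) p = follow_letter y (follow b p).
Proof. exact: foldl_rcons. Qed.

Lemma follow_letterE (N : nat) (y : letter N) p :
  follow_letter y p = tperm (posl y.1) (posr y.1) p.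
Proof.
have ne := negbTE (posl_neq_posr y.1).
rewrite /follow_letter /under_in /under_out /over_in /over_out.
case: tpermP => [->|->|/eqP/negbTE l /eqP/negbTE r]; case: (y.2);
  by rewrite ?eqxx ?l ?r ?[posr _ == _]eq_sym ?ne ?eqxx.
Qed.

Lemma letter_mx1 (F : fieldType) (N : nat) (y : letter N) q p :
  letter_mx (1 : F) y q p = (q == follow_letter y p)%:R.
Proof.
rewrite mxE /letter_weight /letter_step /follow_letter invr1 if_same subrr.
by case: eqP => _; [case: eqP => _; rewrite ?mul0rn | case: eqP].
Qed.

Lemma burau1 (F : fieldType) (N : nat) (b : braid_word N) q p :
  burau (1 : F) b q p = (q == follow b p)%:R.
Proof.
elim/last_ind: b q p => [|b y IH] q p; first by rewrite mxE.
rewrite burau_rcons mxE (bigD1 (follow b p)) //= big1 ?addr0 => [|r rp].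
  by rewrite letter_mx1 IH eqxx mulr1 follow_rcons.
by rewrite IH (negbTE rp) mulr0.
Qed.

(** A row vector killed by 1 - D is constant along a strand as long as the
   strand returns to closed positions, and vanishes where it leaves them. *)
Lemma string_link_det1 (F : fieldType) (n m : nat) (b : braid_word (n + m)) :
  is_string_link b -> \det (1%:M - drsubmx (burau (1 : F) b)) != 0.
Proof.
move=> sl; apply/negP => /det0P[v vn0].
rewrite mulmxBr mulmx1 => /eqP; rewrite subr_eq0 => /eqP vD.
case/negP: vn0; apply/eqP/rowP => p; rewrite mxE.
have [r] := sl (rshift n p) (leq_addr _ _).
(* Induction on the number of turns after which the strand has left. *)
elim: r p => [|r IH] p /=; first by rewrite ltnNge leq_addr.
rewrite -iterS iterSr => Hr; rewrite vD mxE big1 // => q _; rewrite !mxE burau1.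
case: eqP => [e|_]; last by rewrite mulr0.
by rewrite IH ?mul0r // e.
Qed.

(** At s = 1 a crossing is the exchange of two tensor factors, with a sign if
   both are e_1; so a braid permutes the states up to sign. *)
Lemma V_braid1 (F : fieldType) (N : nat) (b : braid_word N) (g : state N) :
  exists2 e : F, e != 0 &
    forall v, V_braid 1 b v g = e * v [ffun p => g (follow b p)].
Proof.
elim/last_ind: b g => [|b y IH] g.
  exists 1; first exact: oner_neq0.
  by move=> v; rewrite V_braid_nil mul1r; congr (v _); apply/ffunP => p; rewrite ffunE.
have [e e0 He] := IH (swap_state y.1 g).
have E1 (v : tensor F N) : V_gen 1 y.1 v g =
    (if g (posl y.1) && g (posr y.1) then -1 else 1) * v (swap_state y.1 g).
  rewrite V_genE invr1 subrr !mul0r !if_same addr0.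
  case: eqP => [ee|ne]; first by rewrite swap_state_id // -ee andbb.
  by move: ne; case: (g _); case: (g _); rewrite //= mul1r.
have E (v : tensor F N) : V_letter 1 y v g =
    (if g (posl y.1) && g (posr y.1) then -1 else 1) * v (swap_state y.1 g).
  rewrite /V_letter; case: (y.2) => //.
  by rewrite V_gen_inv ?oner_neq0 // invr1 subrr scale0r subr0.
exists ((if g (posl y.1) && g (posr y.1) then -1 else 1) * e) => [|v].
  by rewrite mulf_neq0 //; case: ifP; rewrite ?oppr_eq0 oner_neq0.
rewrite V_braid_rcons E He mulrA; congr (_ * v _); apply/ffunP => p.
by rewrite !ffunE follow_rcons follow_letterE.
Qed.

(** A state contributes to the trace only if it is constant along the strands.
   It is 0 at the open positions, and every closed position leads to one of
   them, so only the state 0 contributes, and its weight is nonzero. *)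
Lemma string_link_W01 (F : fieldType) (n m : nat) (b : braid_word (n + m)) :
  is_string_link b -> W0 (1 : F) b != 0.
Proof.
move=> sl; rewrite /W0 V_tangleE sum_ffunE.
rewrite (bigD1 [ffun=> false]) //= big1 => [|c c0].
  rewrite addr0 tensorZ projectE.
  have [e e0 ->] := @V_braid1 F _ b (cat_state [ffun=> false] [ffun=> false]).
  rewrite mulf_neq0 //.
    by rewrite prodf_seq_neq0; apply/allP => j _; rewrite ffunE expr0 mulr1 oner_neq0.
  have -> : [ffun p => cat_state [ffun=> false] [ffun=> false] (follow b p)] =
      cat_state [ffun=> false] [ffun=> false] :> state (n + m).
    by apply/(@ffunP _ (fun=> bool)) => p; rewrite !ffunE; do 2!case: fintype.split => ?; rewrite !ffunE.
  by rewrite embedE eqxx ffunE eqxx mulr1.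
rewrite tensorZ projectE.
have [e _ ->] := @V_braid1 F _ b (cat_state [ffun=> false] c).
set h := [ffun p => _].
suff hc : h != cat_state [ffun=> false] c.
  rewrite (_ : embed _ _ h = 0) ?mulr0 //; move: hc; move: (lstate h) (rstate h) (cat_lrstate h).
  move=> f d <-; rewrite embedE ffunE; have [->|_] := eqVneq d c; last by rewrite mulr0n.
  by have [->|_] := eqVneq f [ffun=> false]; rewrite ?eqxx ?mul0rn.
apply: contra c0 => /eqP hc; apply/eqP/ffunP => j; rewrite [RHS]ffunE.
have hE p : cat_state [ffun=> false] c p = cat_state [ffun=> false] c (follow b p).
  by rewrite -{1}hc ffunE.
rewrite -(cat_state_rshift ([ffun=> false] : state n) c j).
have [r] := sl (rshift n j) (leq_addr _ _).
elim: r (rshift n j) => [|r IH] p /= pn; last by rewrite hE IH // -iterSr.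
by rewrite (_ : p = lshift m (Ordinal pn)) ?cat_state_lshift ?ffunE //; apply: val_inj.
Qed.

(** * Sums over walks in a finite graph *)

Section AbsoluteSums.
Variables (R : realType) (T : choiceType) (D : set T).
Local Open Scope ereal_scope.

Lemma esumZ (c : R) (f : T -> \bar R) : (0 <= c)%R -> (forall x, 0 <= f x) ->
  \esum_(x in D) (c%:E * f x) = c%:E * \esum_(x in D) f x.
Proof.
move=> c0 f0; have [->|cn0] := eqVneq c 0%R.
  by rewrite mul0e esum1 // => x _; rewrite mul0e.
have cp : (0 < c)%R by rewrite lt_neqAle eq_sym cn0.
have le (d : R) (g : T -> \bar R) : (0 <= d)%R -> (forall x, 0 <= g x) ->
    \esum_(x in D) (d%:E * g x) <= d%:E * \esum_(x in D) g x.
  move=> d0 g0; apply: ge_ereal_sup => _ [X [finX XD] <-].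
  rewrite -ge0_mule_fsumr //.
  by apply: lee_wpmul2l; [rewrite lee_fin | apply: esum_ge; exists X].
apply/eqP; rewrite eq_le le //= -lee_pdivlMl //.
have -> : \esum_(x in D) f x = \esum_(x in D) (c^-1%:E * (c%:E * f x)).
  by apply: eq_esum => x _; rewrite muleA -EFinM mulVf // mul1e.
apply: le => [|x]; first by rewrite invr_ge0.
by rewrite mule_ge0 // lee_fin.
Qed.

Definition signed_sum (f : T -> R) : R :=
  (fine (\esum_(x in D) (EFin \o f)^\+ x)%E - fine (\esum_(x in D) (EFin \o f)^\- x)%E)%R.

Lemma esum_pos_fin (f : T -> R) : summable D (EFin \o f) ->
  \esum_(x in D) (EFin \o f)^\+ x \is a fin_num.
Proof.
move=> /summable_funepos; rewrite summableE; congr (_ \is a fin_num).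
by apply: eq_esum => x _; rewrite gee0_abs.
Qed.

Lemma esum_neg_fin (f : T -> R) : summable D (EFin \o f) ->
  \esum_(x in D) (EFin \o f)^\- x \is a fin_num.
Proof.
move=> /summable_funeneg; rewrite summableE; congr (_ \is a fin_num).
by apply: eq_esum => x _; rewrite gee0_abs.
Qed.

Lemma abs_sums_to_signed_sum (f : T -> R) : summable D (EFin \o f) ->
  abs_sums_to D f (signed_sum f).
Proof.
move=> sf; split=> //; rewrite /signed_sum EFinB !fineK //.
  exact: esum_neg_fin.
exact: esum_pos_fin.
Qed.

Lemma funepos_EFin (f : T -> R) x : (EFin \o f)^\+ x = (Num.max (f x) 0)%:E.
Proof. by rewrite funeposE /= EFin_max. Qed.

Lemma funeneg_EFin (f : T -> R) x : (EFin \o f)^\- x = (Num.max (- f x) 0)%:E.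
Proof. by rewrite funenegE /= EFin_max EFinN. Qed.

Lemma signed_sumZ (c : R) (f : T -> R) : summable D (EFin \o f) ->
  signed_sum (fun x => c * f x)%R = (c * signed_sum f)%R.
Proof.
move=> sf; rewrite /signed_sum.
have [c0|c0] := leP 0%R c.
  have -> : \esum_(x in D) (EFin \o (fun x => c * f x)%R)^\+ x =
            c%:E * \esum_(x in D) (EFin \o f)^\+ x.
    rewrite -esumZ //; apply: eq_esum => x _.
    by rewrite !funepos_EFin -EFinM maxr_pMr // mulr0.
  have -> : \esum_(x in D) (EFin \o (fun x => c * f x)%R)^\- x =
            c%:E * \esum_(x in D) (EFin \o f)^\- x.
    rewrite -esumZ //; apply: eq_esum => x _.
    by rewrite !funeneg_EFin -EFinM maxr_pMr // mulr0 mulrN.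
  by rewrite !fineM ?esum_pos_fin ?esum_neg_fin //= mulrBr.
have c0' : (0 <= - c)%R by rewrite oppr_ge0 ltW.
have -> : \esum_(x in D) (EFin \o (fun x => c * f x)%R)^\+ x =
          (- c)%:E * \esum_(x in D) (EFin \o f)^\- x.
  rewrite -esumZ //; apply: eq_esum => x _.
  by rewrite funepos_EFin funeneg_EFin -EFinM maxr_pMr // mulr0 mulrNN.
have -> : \esum_(x in D) (EFin \o (fun x => c * f x)%R)^\- x =
          (- c)%:E * \esum_(x in D) (EFin \o f)^\+ x.
  rewrite -esumZ //; apply: eq_esum => x _.
  by rewrite funepos_EFin funeneg_EFin -EFinM maxr_pMr // mulr0 mulNr.
rewrite !fineM ?esum_pos_fin ?esum_neg_fin //=; ring.
Qed.

End AbsoluteSums.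

Section Walks.
Variables (R : realType) (P : finType) (e : rel P) (w : P -> P -> R) (z : P).
(* The empty walk is thus the only walk from z to z. *)
Hypothesis sink : forall a, e z a = false.

Definition walks (a : P) : set (seq P) :=
  [set p | path e a p /\ last a p = z]%classic.

Definition walk_weight (a : P) (p : seq P) : R :=
  \prod_(u <- pairmap w a p) u.

Lemma walk_weight_cons a a' p :
  walk_weight a (a' :: p) = w a a' * walk_weight a' p.
Proof. by rewrite /walk_weight /= big_cons. Qed.

Lemma walks_sink : walks z = [set [::]]%classic.
Proof.
apply/seteqP; split=> [[|a p] //= [/andP[za _] _]|p ->] //.
by move: za; rewrite sink.
Qed.

(** The decomposition of a nonempty walk into its first step and the rest. *)
Lemma esum_walks (a : P) (F : seq P -> \bar R) : a != z ->
  (forall p, (0 <= F p)%E) ->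
  (\esum_(p in walks a) F p =
   \sum_(a' | e a a') \esum_(p in walks a') F (a' :: p))%E.
Proof.
move=> az F0.
have -> : (\sum_(a' | e a a') \esum_(p in walks a') F (a' :: p) =
    \esum_(a' in [set a' | e a a']%classic) \esum_(p in walks a') F (a' :: p))%E.
  rewrite esum_fset; [|exact: finite_finset | by move=> *; exact: esum_ge0].
  rewrite -[LHS]big_filter fsbig_seq ?filter_uniq ?index_enum_uniq //=.
  apply: eq_fsbigl; apply/seteqP.
  by split=> a' /=; rewrite mem_filter mem_index_enum andbT.
rewrite esum_esum //; apply: reindex_esum; split.
- by move=> [a' p] /= [ea [pa la]]; split=> //=; rewrite ea.
- by move=> [a' p] [b' q] _ _ [-> ->].
- move=> [|a' p] [/= pp lp]; first by rewrite lp eqxx in az.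
  by case/andP: pp => ea pp; exists (a', p).
Qed.

Variable pot : P -> R.
Hypothesis pot_ge0 : forall a, 0 <= pot a.
Hypothesis pot_sink : 1 <= pot z.
Hypothesis pot_step : forall a, a != z ->
  \sum_(a' | e a a') `|w a a'| * pot a' <= pot a.

(** The bound on the length allows an induction on the first step, where pot
   is superharmonic; the estimate does not depend on that bound. *)
Lemma esum_short_walks (L : nat) (a : P) :
  (\esum_(p in walks a) (`|walk_weight a p| *+ (size p <= L))%:E <= (pot a)%:E)%E.
Proof.
have F0 K b p : (0 <= (`|walk_weight b p| *+ (size p <= K)%N)%:E)%E.
  by rewrite lee_fin mulrn_wge0.
elim: L a => [|L IH] a; (have [->|az] := eqVneq a z;
  [by rewrite walks_sink esum_set1 // /walk_weight big_nil normr1 lee_fin|]).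
  rewrite esum1 ?lee_fin // => [[|a' p]] [/= _ la]; last by rewrite mulr0n.
  by rewrite la eqxx in az.
rewrite esum_walks //.
apply: le_trans (_ : (\sum_(a' | e a a') (`|w a a'| * pot a')%:E <= _)%E).
  apply: lee_sum => a' _.
  rewrite (eq_esum (b := fun p => (`|w a a'|%:E *
      (`|walk_weight a' p| *+ (size p <= L)%N)%:E)%E)); last first.
    move=> p _; by rewrite -EFinM walk_weight_cons normrM mulrnAr.
  rewrite esumZ ?EFinM //.
  by apply: lee_wpmul2l; rewrite ?lee_fin //; exact: IH.
by rewrite sumEFin lee_fin pot_step.
Qed.

Lemma walks_summable (a : P) : summable (walks a) (EFin \o walk_weight a).
Proof.
apply: (@le_lt_trans _ _ (pot a)%:E); last exact: ltry.
apply: ge_ereal_sup => _ [X [finX XD] <-].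
have [r Xr] := (finite_seqP X).1 finX.
pose L := (\max_(p <- r) size p)%N.
apply: le_trans (esum_short_walks L a); apply: esum_ge; exists X => //.
rewrite le_eqVlt; apply/orP; left; apply/eqP; apply: eq_fsbigr => p pX /=.
have -> : (size p <= L)%N; last by rewrite mulr1n.
by apply: leq_bigmax_seq => //; move/set_mem: pX; rewrite Xr.
Qed.

Definition walk_sum (a : P) : R := signed_sum (walks a) (walk_weight a).

Lemma walk_sum_abs (a : P) : abs_sums_to (walks a) (walk_weight a) (walk_sum a).
Proof. exact/abs_sums_to_signed_sum/walks_summable. Qed.

Lemma walk_sum_sink : walk_sum z = 1.
Proof.
rewrite /walk_sum /signed_sum walks_sink !esum_set1 //.
rewrite funepos_EFin funeneg_EFin /walk_weight big_nil /=.
by rewrite max_l // max_r ?subr0 // oppr_le0.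
Qed.

(** Positive and negative parts satisfy the first-step equation separately,
   with the two parts exchanged where the weight of the first step is
   negative; signed_sumZ accounts for this. *)
Lemma walk_sum_step (a : P) : a != z ->
  walk_sum a = \sum_(a' | e a a') w a a' * walk_sum a'.
Proof.
move=> az; rewrite /walk_sum {1}/signed_sum !esum_walks //.
pose f a' p := w a a' * walk_weight a' p.
have sf a' : e a a' -> summable (walks a') (EFin \o f a').
  move=> ea; rewrite /summable (eq_esum (b := fun p => (`|w a a'|%:E *
      `|(EFin \o walk_weight a') p|)%E)); last by move=> p _; rewrite /= normrM EFinM.
  rewrite esumZ //; apply: lte_mul_pinfty; rewrite ?lee_fin //.
  exact: walks_summable.
have E a' : (\esum_(p in walks a') (EFin \o walk_weight a)^\+ (a' :: p) =
    \esum_(p in walks a') (EFin \o f a')^\+ p)%E.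
  by apply: eq_esum => p _; rewrite !funepos_EFin walk_weight_cons.
have E' a' : (\esum_(p in walks a') (EFin \o walk_weight a)^\- (a' :: p) =
    \esum_(p in walks a') (EFin \o f a')^\- p)%E.
  by apply: eq_esum => p _; rewrite !funeneg_EFin walk_weight_cons.
under eq_bigr do rewrite E; under [X in _ - fine X = _]eq_bigr do rewrite E'.
rewrite -!sum_fine; last 2 first.
  by move=> a' ea; exact/esum_neg_fin/sf.
  by move=> a' ea; exact/esum_pos_fin/sf.
rewrite -sumrB; apply: eq_bigr => a' ea.
by rewrite -signed_sumZ //; exact: walks_summable.
Qed.

End Walks.

(** * Walks in a closed braid *)

Lemma burau_cons (F : fieldType) (t : F) (N : nat) (x : letter N) (b : braid_word N) :
  burau t (x :: b) = burau t b *m letter_mx t x.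
Proof.
elim/last_ind: b => [|b y IH]; first by rewrite /burau /= mulmx1 mul1mx.
by rewrite -rcons_cons !burau_rcons IH mulmxA.
Qed.

Lemma cvg_big_sum (R : realType) (I : Type) (r : seq I) (f : I -> R -> R)
    (l : I -> R) (x : R) :
  (forall i, f i t @[t --> x] --> l i)%classic ->
  ((\sum_(i <- r) f i t) @[t --> x] --> \sum_(i <- r) l i)%classic.
Proof.
move=> H; elim: r => [|i r IH].
  by under eq_cvg do rewrite big_nil; rewrite big_nil; exact: cvg_cst.
by under eq_cvg do rewrite big_cons; rewrite big_cons; exact: cvgD.
Qed.

Section ClosedDiagram.
Variables (R : realType) (n m : nat) (b : braid_word (n + m)).

Lemma onth_size_lt (l : nat) : (l < size b)%N ->
  exists2 x, onth b l = Some x & drop l b = x :: drop l.+1 b.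
Proof.
elim: b l => [//|y c IH] [|l] /= lc; first by exists y; rewrite ?drop0.
by have [x xl dl] := IH l lc; exists x.
Qed.

Lemma onth_size : onth b (size b) = None.
Proof. by elim: b. Qed.

(** The function g is the identity for the sums themselves and the absolute
   value for their bounds. *)
Lemma dstep_sum (F : fieldType) (t : F) (K : pzRingType) (g : F -> K)
    (f : dpoint b -> K) (l l' : 'I_(size b).+1) (p : 'I_(n + m)) x :
  g 0 = 0 -> onth b l = Some x -> l' = l.+1 :> nat ->
  \sum_(Q | dstep (l, p) Q) g (dstep_weight t (l, p) Q) * f Q =
  \sum_q g (letter_mx t x q p) * f (l', q).
Proof.
move=> g0 xl ll'; rewrite /dstep /dstep_weight /= xl.
rewrite (eq_bigr (fun Q => g (letter_weight t x p Q.2) * f (Q.1, Q.2))); last by case.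
rewrite -(pair_big_dep (fun l1 : 'I_(size b).+1 => l1 == l.+1 :> nat)
  (fun _ q => letter_step x p q)
  (fun l1 q => g (letter_weight t x p q) * f (l1, q))) /=.
rewrite (eq_bigl (fun l1 => l1 == l')); last by move=> l1; rewrite -val_eqE /= ll'.
rewrite big_pred1_eq big_mkcond; apply: eq_bigr => q _; rewrite mxE.
by case: ifP; rewrite ?mulr1n // mulr0n g0 mul0r.
Qed.

Lemma dstep_sum_top (F : fieldType) (t : F) (K : pzRingType) (g : F -> K)
    (f : dpoint b -> K) (p : 'I_(n + m)) :
  \sum_(Q | dstep (ord_max, p) Q) g (dstep_weight t (ord_max, p) Q) * f Q =
  if (n <= p)%N then g 1 * f (ord0, p) else 0.
Proof.
rewrite /dstep /dstep_weight /= onth_size; case: leqP => np /=; last exact: big_pred0_eq.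
rewrite (eq_bigl (fun Q => Q == (ord0, p))); first by rewrite big_pred1_eq.
by move=> -[l q]; rewrite xpair_eqE -val_eqE.
Qed.

Lemma dtop_sink (j : 'I_n) (Q : dpoint b) : dstep (dtop b j) Q = false.
Proof. by rewrite /dstep /= onth_size leqNgt ltn_ord. Qed.

Hypothesis sl : is_string_link b.

Lemma exits (p : 'I_(n + m)) : exists r, (iter r (follow b) p < n)%N.
Proof. by case: (leqP n p) => [/sl//|pn]; exists 0%N. Qed.

Definition exit_time (p : 'I_(n + m)) : nat := ex_minn (exits p).

Lemma exit_time_follow (p : 'I_(n + m)) : (n <= p)%N ->
  (exit_time (follow b p) < exit_time p)%N.
Proof.
move=> np; rewrite /exit_time; case: ex_minnP => r _ rmin; case: ex_minnP => -[|r'].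
  by rewrite /= ltnNge np.
by rewrite iterSr => /rmin.
Qed.

(** At the top this is the exit time plus one; below, it is forced by the
   requirement of being harmonic for the absolute values of the weights. Only
   the closing arcs then impose a condition. *)
Fixpoint potential (t : R) (c : braid_word (n + m)) (p : 'I_(n + m)) : R :=
  if c is x :: c' then \sum_q `|letter_mx t x q p| * potential t c' q
  else (exit_time p).+1%:R.

Lemma potential_ge0 t c p : 0 <= potential t c p.
Proof.
elim: c p => [|x c IH] p /=; first exact: ler0n.
by apply: sumr_ge0 => q _; rewrite mulr_ge0.
Qed.

Lemma potential1 c p : potential 1 c p = (exit_time (follow c p)).+1%:R.
Proof.
elim: c p => [|x c IH] p //=; rewrite (bigD1 (follow_letter x p)) //= big1 ?addr0.
  by rewrite letter_mx1 eqxx normr1 mul1r IH.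
by move=> q qp; rewrite letter_mx1 (negbTE qp) normr0 mul0r.
Qed.

Lemma letter_mx_continuous (x : letter (n + m)) q p :
  ((letter_mx t x q p : R) @[t --> (1 : R)] --> (letter_mx 1 x q p : R))%classic.
Proof.
have cV : ((if x.2 then t else t^-1 : R) @[t --> (1 : R)] --> (if x.2 then 1 else 1^-1 : R))%classic.
  by case: (x.2); [exact: cvg_id | apply: cvgV; [exact: oner_neq0 | exact: cvg_id]].
rewrite mxE; under eq_cvg do rewrite mxE /letter_weight.
case: (letter_step x p q); last by rewrite !mulr0n; exact: cvg_cst.
rewrite /letter_weight !mulr1n; case: (p == _); last exact: cvg_cst.
by case: (q == _) => //; apply: cvgB cV; exact: cvg_cst.
Qed.

Lemma potential_continuous c p :
  (potential t c p @[t --> (1 : R)] --> potential 1 c p)%classic.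
Proof.
elim: c p => [|x c IH] p /=; first exact: cvg_cst.
apply: (cvg_big_sum (f := fun q t => `|letter_mx t x q p| * potential t c q)
  (l := fun q => `|letter_mx 1 x q p| * potential 1 c q)) => q.
by apply: cvgM (IH q); apply: cvg_norm; exact: letter_mx_continuous.
Qed.

(** At t = 1 a turn through the braid lowers the exit time of a closed
   position, so the inequality is strict there and persists nearby. *)
Lemma near_potential :
  \forall t \near (1 : R), forall p : 'I_(n + m), (n <= p)%N ->
    potential t b p <= (exit_time p).+1%:R.
Proof.
suff H (p : 'I_(n + m)) : \forall t \near (1 : R), (n <= p)%N ->
    potential t b p <= (exit_time p).+1%:R by exact: filter_forall H.
case: (leqP n p) => np; last first.
  by near=> t.
have lt1 : potential 1 b p < (exit_time p).+1%:R.
  by rewrite potential1 ltr_nat ltnS exit_time_follow.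
near=> t => _; apply: ltW; near: t.
exact: cvgr_lt (@potential_continuous b p) _ lt1.
Unshelve. all: by end_near.
Qed.

Section Summation.
Variables (t : R) (j : 'I_n).
Hypothesis pot_le : forall p : 'I_(n + m), (n <= p)%N ->
  potential t b p <= (exit_time p).+1%:R.
Hypothesis unitD : 1%:M - drsubmx (burau t b) \in unitmx.

Let pot (Q : dpoint b) : R := potential t (drop Q.1 b) Q.2.

Lemma pot_step (Q : dpoint b) :
  \sum_(Q' | dstep Q Q') `|dstep_weight t Q Q'| * pot Q' <= pot Q.
Proof.
case: Q => l p; have [lb|bl] := ltnP l (size b).
  have [x xl dl] := onth_size_lt lb.
  rewrite (@dstep_sum _ t _ Num.norm pot l (inord l.+1) p x) ?normr0 ?inordK //.
  by rewrite /pot /= dl inordK.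
have -> : l = ord_max by apply/val_inj/eqP; rewrite eqn_leq bl -ltnS ltn_ord.
rewrite (dstep_sum_top t Num.norm) normr1 mul1r /pot /= drop0 drop_size /=.
by case: ifP => [/pot_le|].
Qed.

Let path_sum : dpoint b -> R := walk_sum (@dstep n m b) (@dstep_weight R t n m b) (dtop b j).

Lemma path_sum_step (Q : dpoint b) : Q != dtop b j ->
  path_sum Q = \sum_(Q' | dstep Q Q') dstep_weight t Q Q' * path_sum Q'.
Proof.
apply: (@walk_sum_step _ _ _ _ _ (dtop_sink j) pot) => [Q'||Q' _].
- exact: potential_ge0.
- rewrite /pot /= drop_size /= ler1n //.
- exact: pot_step.
Qed.

Lemma path_sum_abs (i : 'I_n) :
  abs_sums_to (@admissible n m b i j) (@path_weight R t n m b i) (path_sum (dbottom b i)).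
Proof.
apply: (@walk_sum_abs _ _ _ _ _ (dtop_sink j) pot) => [Q'||Q' _].
- exact: potential_ge0.
- rewrite /pot /= drop_size /= ler1n //.
- exact: pot_step.
Qed.

Lemma path_sum_up (l : 'I_(size b).+1) (p : 'I_(n + m)) :
  path_sum (l, p) = \sum_q burau t (drop l b) q p * path_sum (ord_max, q).
Proof.
have [k] := ubnP (size b - l); elim: k l p => // k IH l p lk.
have [lb|bl] := ltnP l (size b); last first.
  have -> : l = ord_max by apply/val_inj/eqP; rewrite eqn_leq bl -ltnS ltn_ord.
  rewrite /= drop_size (bigD1 p) //= big1 ?addr0 /burau /=.
    by rewrite mxE eqxx mul1r.
  by move=> q qp; rewrite mxE (negbTE qp) mul0r.
have [x xl dl] := onth_size_lt lb.
have lmax : l != ord_max by rewrite -val_eqE /= neq_ltn lb.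
rewrite path_sum_step; last by rewrite xpair_eqE (negbTE lmax).
rewrite (@dstep_sum _ t _ id path_sum l (inord l.+1) p x) ?inordK // dl burau_cons.
under [RHS]eq_bigr do rewrite mxE mulr_suml.
rewrite exchange_big; apply: eq_bigr => q _ /=.
rewrite IH inordK //; last by lia.
by rewrite mulr_sumr; apply: eq_bigr => r _; ring.
Qed.

Lemma path_sum_top (q : 'I_(n + m)) :
  path_sum (ord_max, q) = if (n <= q)%N then path_sum (ord0, q) else (q == lshift m j)%:R.
Proof.
have [->|qj] := eqVneq q (lshift m j).
  rewrite /= leqNgt ltn_ord /=; exact: walk_sum_sink (dtop_sink j).
rewrite path_sum_step; last by rewrite xpair_eqE eqxx.
by rewrite (dstep_sum_top t id); case: ifP => //; rewrite mul1r.
Qed.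

(** Running along the closing arcs identifies the sums at the closed positions
   above and below the braid; solving for these inverts 1 - D. *)
Lemma path_sum_bottom (i : 'I_n) : path_sum (dbottom b i) = closure_mx (burau t b) j i.
Proof.
pose M := burau t b; pose d : 'rV[R]_n := delta_mx 0 j.
pose sig : 'rV[R]_(n + m) := \row_p path_sum (ord0, p).
have E : sig = row_mx d (rsubmx sig) *m M.
  apply/rowP => p; rewrite !mxE path_sum_up drop0; apply: eq_bigr => q _.
  rewrite mulrC path_sum_top -/M; congr (_ * _); rewrite mxE.
  case: splitP => k e.
    by rewrite e leqNgt ltn_ord !mxE eqxx -val_eqE /= e.
  by rewrite e leq_addr !mxE; congr (path_sum (_, _)); apply: val_inj.
have [E1 E2] : lsubmx sig = d *m ulsubmx M + rsubmx sig *m dlsubmx M /\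
    rsubmx sig = d *m ursubmx M + rsubmx sig *m drsubmx M.
  apply: eq_row_mx; rewrite hsubmxK {1}E -{1}(submxK M) mul_row_block //.
have E3 : rsubmx sig = d *m ursubmx M *m invmx (1%:M - drsubmx M).
  apply: (canRL (mulmxK unitD)).
  by rewrite mulmxBr mulmx1 {1}E2 addrK.
have -> : path_sum (dbottom b i) = lsubmx sig 0 i by rewrite !mxE.
rewrite E1 E3 -!mulmxA -mulmxDr !mulmxA -/(closure_mx M).
by rewrite -rowE mxE.
Qed.

End Summation.
End ClosedDiagram.

(** * The random walk invariant as a rational function *)

Section RandomWalk.
Variables (R : realType).

Definition eval_at (t : R) : {rmorphism {poly rat} -> R} :=
  horner_eval t \o map_poly ratr.

Lemma near_eval_neq0 (q : {poly rat}) : eval_at 1 q != 0 ->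
  \forall t \near (1 : R), eval_at t q != 0.
Proof.
move=> q1; have := @continuous_horner R (map_poly ratr q) 1.
move=> /cvgr_neq0; exact.
Qed.

(** The points 1 + e / (k + 2) are more roots than a nonzero polynomial has. *)
Lemma poly_near_eq0 (p : {poly rat}) :
  (\forall t \near (1 : R), eval_at t p = 0) -> p = 0.
Proof.
move=> /nbhs_ballP[e /= e0 He].
have e0' : 0 < e by [].
(* The denominator k + 2 keeps the points strictly inside the ball. *)
pose x (k : nat) : R := 1 + e / k.+2%:R.
have xroot k : root (map_poly ratr p) (x k).
  apply/rootP; apply: He; rewrite /ball /= /x opprD addrA subrr sub0r normrN.
  rewrite ger0_norm ?divr_ge0 // ?ltW // ltr_pdivrMr ?ltr0n // ltr_pMr // ltr1n //.
have xinj : injective x.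
  move=> k l /addrI /(mulfI (lt0r_neq0 e0')) /invr_inj /eqP.
  by rewrite eqr_nat => /eqP[].
apply/eqP; rewrite -(map_poly_eq0 (ratr : {rmorphism rat -> R})); apply/negPn/negP => p0.
have := @max_poly_roots _ _ (map x (iota 0 (size (map_poly (ratr : rat -> R) p)))) p0.
rewrite size_map size_iota ltnn map_inj_uniq // iota_uniq => /(_ _ isT) H.
by apply: notF; apply: H; apply/allP => _ /mapP[k _ ->].
Qed.

Lemma is_rw_entry_unique (n m : nat) (b : braid_word (n + m)) (j i : 'I_n) r r' :
  is_rw_entry R b j i r -> is_rw_entry R b j i r' -> r = r'.
Proof.
move=> [p [q [q0 -> Hp]]] [p' [q' [q0' -> Hp']]].
apply/eqP; rewrite eqr_div ?tofrac_eq0 // -!rmorphM tofrac_eq -subr_eq0; apply/eqP.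
apply: poly_near_eq0; near=> t.
have [qt [_ st]] : (map_poly ratr q).[t] != 0 /\
    abs_sums_to (@admissible n m b i j) (@path_weight R t n m b i)
      ((map_poly ratr p).[t] / (map_poly ratr q).[t]) by near: t.
have [qt' [_]] : (map_poly ratr q').[t] != 0 /\
    abs_sums_to (@admissible n m b i j) (@path_weight R t n m b i)
      ((map_poly ratr p').[t] / (map_poly ratr q').[t]) by near: t.
rewrite st => -[/eqP]; rewrite eqr_div // => /eqP e.
by rewrite rmorphB !rmorphM /= /horner_eval e subrr.
Unshelve. all: by end_near.
Qed.

Lemma eval_at_X (t : R) : specializes (eval_at t) (FracField.tofrac 'X) t.
Proof.
by have := specializes_poly (eval_at t) 'X; rewrite /= /horner_eval map_polyX hornerX.
Qed.

(** A single fraction must serve for all t near 1: the one obtained from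
   regularity at t = 1 is also valid wherever its denominator and that of
   det (1 - D) do not vanish. *)
Lemma rw_entry (n m : nat) (b : braid_word (n + m)) (j i : 'I_n) :
  is_string_link b ->
  is_rw_entry R b j i (closure_mx (burau (FracField.tofrac 'X) b) j i).
Proof.
move=> sl; set r := closure_mx _ j i.
have sp t : t != 0 -> specializes_mx (eval_at t) (burau (FracField.tofrac 'X) b) (burau t b).
  by move=> t0; apply: specializes_burau => //; exact: eval_at_X.
have spD t : t != 0 -> specializes (eval_at t)
    (\det (1%:M - drsubmx (burau (FracField.tofrac 'X) b)))
    (\det (1%:M - drsubmx (burau t b))).
  move=> /sp H; apply: specializes_det; apply: specializes_addmx.
    exact: specializes_scalar_mx1.
  by apply: specializes_oppmx => k l; rewrite !mxE.
have D1 := string_link_det1 R sl.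
have n1 : (1 : R) != 0 := oner_neq0 _.
have [u [v [v1 dE d1]]] := spD 1 n1.
have u1 : eval_at 1 u != 0.
  by apply: contra D1 => /eqP u1; rewrite d1 u1 mul0r.
have [p [q [q1 rE _]]] := specializes_closure D1 (sp 1 n1) j i.
exists p, q; split=> //; first by apply: contra q1 => /eqP ->; rewrite rmorph0.
near=> t.
have t0 : t != 0.
  by near: t; apply: (@cvgr_neq0 _ _ _ _ _ id (1 : R)) => //; exact: cvg_id.
have qt : eval_at t q != 0 by near: t; exact: near_eval_neq0.
have ut : eval_at t u != 0 by near: t; exact: near_eval_neq0.
have vt : eval_at t v != 0 by near: t; exact: near_eval_neq0.
have Dt : \det (1%:M - drsubmx (burau t b)) != 0.
  rewrite (specializes_unique (spD t t0) (y' := eval_at t u / eval_at t v)).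
    by rewrite mulf_neq0 ?invr_eq0.
  by exists u, v.
split=> //; have -> : (map_poly ratr p).[t] / (map_poly ratr q).[t] =
    closure_mx (burau t b) j i.
  apply: (@specializes_unique _ (eval_at t) r); last exact: specializes_closure Dt (sp t t0) j i.
  by exists p, q.
have pot : forall a : 'I_(n + m), (n <= a)%N ->
    potential sl t b a <= (exit_time sl a).+1%:R by near: t; exact: near_potential.
have uD : 1%:M - drsubmx (burau t b) \in unitmx by rewrite unitmxE unitfE.
by rewrite -(path_sum_bottom j pot uD i); exact: path_sum_abs.
Unshelve. all: by end_near.
Qed.

Lemma rw_closure (n m : nat) (b : braid_word (n + m)) : is_string_link b ->
  rw R b = closure_mx (burau (FracField.tofrac 'X) b).
Proof.
move=> sl; apply/matrixP => j i; rewrite mxE.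
apply: xget_unique; first exact: rw_entry.
by move=> r Hr; apply: is_rw_entry_unique Hr _; exact: rw_entry.
Qed.

End RandomWalk.

(** * The substitution of s ^ 2 for t *)

Lemma fraction_repr (r : ratfrac) :
  r = FracField.tofrac (repr r).1 / FracField.tofrac (repr r).2.
Proof.
have d0 := denom_ratioP (repr r).
apply: (canRL (mulfK _)); first by rewrite tofrac_eq0.
rewrite -{1}[r]reprK; unlock FracField.tofrac; rewrite -[LHS]FracField.pi_mul.
apply/eqmodP; rewrite /= FracField.equivfE /FracField.mulf.
by rewrite !numden_Ratio ?mulf_neq0 ?oner_neq0 //= !mulr1 mulrC.
Qed.

Lemma fraction_quotient (r : ratfrac) :
  exists p q : {poly rat}, q != 0 /\ r = FracField.tofrac p / FracField.tofrac q.
Proof.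
exists (repr r).1, (repr r).2; split; last exact: fraction_repr.
exact: denom_ratioP.
Qed.

Lemma comp_polyX2_eq0 (p : {poly rat}) : (p \Po 'X^2 == 0) = (p == 0).
Proof.
apply: comp_poly_eq0. by rewrite size_polyXn.
Qed.

(** The definition of sqrt_ext uses a chosen representative; any other one
   gives the same value. *)
Lemma sqrt_ext_frac (p q : {poly rat}) : q != 0 ->
  sqrt_ext (FracField.tofrac p / FracField.tofrac q) =
  FracField.tofrac (p \Po 'X^2) / FracField.tofrac (q \Po 'X^2).
Proof.
move=> q0; have := fraction_repr (FracField.tofrac p / FracField.tofrac q).
rewrite /sqrt_ext; move: (repr _) => [[p' q'] /= q0'] /eqP.
rewrite eqr_div ?tofrac_eq0 // -!tofracM tofrac_eq => /eqP e; apply/eqP.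
rewrite eqr_div ?tofrac_eq0 ?comp_polyX2_eq0 // -!tofracM tofrac_eq.
by rewrite -!comp_polyM e.
Qed.

Lemma sqrt_ext_is_zmod_morphism : zmod_morphism sqrt_ext.
Proof.
move=> x y; have [p [q [q0 ->]]] := fraction_quotient x.
have [p' [q' [q0' ->]]] := fraction_quotient y; rewrite !sqrt_ext_frac //.
rewrite -!mulNr -!tofracN.
rewrite !addf_div ?tofrac_eq0 ?comp_polyX2_eq0 // -!tofracM -!tofracD.
by rewrite sqrt_ext_frac ?mulf_neq0 // !mulNr comp_polyB !comp_polyM.
Qed.

Lemma sqrt_ext_is_monoid_morphism : monoid_morphism sqrt_ext.
Proof.
split=> [|x y].
  have := @sqrt_ext_frac 1 1 (oner_neq0 _).
  by rewrite -polyC1 comp_polyC !rmorph1 divr1.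
have [p [q [q0 ->]]] := fraction_quotient x.
have [p' [q' [q0' ->]]] := fraction_quotient y; rewrite !sqrt_ext_frac // !mulf_div -!tofracM.
by rewrite sqrt_ext_frac ?mulf_neq0 // !comp_polyM.
Qed.

HB.instance Definition _ :=
  GRing.isZmodMorphism.Build ratfrac ratfrac sqrt_ext sqrt_ext_is_zmod_morphism.
HB.instance Definition _ :=
  GRing.isMonoidMorphism.Build ratfrac ratfrac sqrt_ext sqrt_ext_is_monoid_morphism.

Lemma sqrt_ext_X : sqrt_ext (FracField.tofrac 'X) = sqrt_t ^+ 2.
Proof.
have := @sqrt_ext_frac 'X 1 (oner_neq0 _).
by rewrite -polyC1 comp_polyC comp_polyX !rmorph1 !divr1 rmorphXn.
Qed.

Lemma map_letter_mx (E F : fieldType) (h : {rmorphism E -> F}) (t : E) (N : nat)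
    (x : letter N) : map_mx h (letter_mx t x) = letter_mx (h t) x.
Proof.
apply/matrixP => q p; rewrite !mxE rmorphMn; congr (_ *+ _).
rewrite /letter_weight; case: (p == _); last exact: rmorph1.
by case: (q == _); case: (x.2); rewrite ?rmorphB ?rmorph1 ?fmorphV.
Qed.

Lemma map_burau (E F : fieldType) (h : {rmorphism E -> F}) (t : E) (N : nat)
    (b : braid_word N) : map_mx h (burau t b) = burau (h t) b.
Proof.
elim/last_ind: b => [|b x IH]; first exact: map_mx1.
by rewrite !burau_rcons map_mxM IH map_letter_mx.
Qed.

Lemma map_closure_mx (E F : fieldType) (h : {rmorphism E -> F}) (n m : nat)
    (M : 'M[E]_(n + m)) : map_mx h (closure_mx M) = closure_mx (map_mx h M).
Proof.
rewrite /closure_mx map_mxD !map_mxM map_invmx map_mxB map_mx1.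
by rewrite map_ulsubmx map_ursubmx map_dlsubmx map_drsubmx.
Qed.

Theorem theorem1 (R : realType) (n k : nat) (hn : (1 <= n)%N) (hk : (k <= n)%N) :
  exists Phi : {linear subvs_of (Wspace ratfrac n k) -> extpow ratfrac k n},
    bijective Phi /\
    forall (m : nat) (b : braid_word (n + m)), is_string_link b ->
      forall w : subvs_of (Wspace ratfrac n k),
        Phi (W_over0 sqrt_t b w)
        = extpow_map (map_mx sqrt_ext (rw R b)) (Phi w).
Proof.
have s0 : sqrt_t != 0 by rewrite tofrac_eq0 polyX_eq0.
exists (@Wcoord ratfrac sqrt_t n k : {linear _ -> _}); split; first exact: Wcoord_bij.
move=> m b sl w.
have n1 : (1 : R) != 0 := oner_neq0 _.
(* The value 1 is taken by s here, and then also by t = s ^ 2. *)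
have sX := eval_at_X (1 : R).
have W0n : W0 sqrt_t b != 0.
  exact: specializes_neq0 (specializes_W0 b n1 sX) (string_link_W01 R sl).
have uD : 1%:M - drsubmx (burau (sqrt_t ^+ 2) b) \in unitmx.
  rewrite unitmxE unitfE; apply: (@specializes_neq0 _ (eval_at (1 : R)) _ _ _ (string_link_det1 R sl)).
  apply: specializes_det; apply: specializes_addmx; first exact: specializes_scalar_mx1.
  apply: specializes_oppmx => i j; rewrite !mxE; apply: specializes_burau => //.
  by have := specializesX 2 sX; rewrite expr1n.
have -> : map_mx sqrt_ext (rw R b) = closure_mx (burau (sqrt_t ^+ 2) b).
  by rewrite rw_closure // map_closure_mx map_burau /= sqrt_ext_X.
exact (Wcoord_W_over0 s0 w uD W0n).
Qed.
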